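(* Let $n\geq 17$ be an integer. Among all outerplanar graphs on $n$ vertices, the graph $K_1\vee P_{n-1}$ attains the maximum spectral radius; that is, $K_1\vee P_{n-1}$ is outerplanar and $\lambda(G)\leq \lambda(K_1\vee P_{n-1})$ for every outerplanar graph $G$ on $n$ vertices.
   Context: Graphs are finite, simple and undirected. A graph is outerplanar if it has a planar embedding in which all vertices lie on the boundary of its outer face. $\lambda(G)$ denotes the spectral radius of the adjacency matrix $A(G)$ of $G$. $K_1$ is a single vertex and $P_m$ is the path on $m$ vertices. For disjoint graphs $G_1,G_2$, the join $G_1\vee G_2$ is the graph with vertex set $V(G_1)\cup V(G_2)$ and edge set $E(G_1)\cup E(G_2)\cup\{xy: x\in V(G_1), y\in V(G_2)\}$. *)

(* Defs.v *)
From HB Require Import structures.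
From mathcomp Require Import all_boot all_order all_algebra.
From mathcomp Require Import all_classical all_reals all_analysis.
From mathcomp Require Import complex.

Set Implicit Arguments.
Unset Strict Implicit.
Unset Printing Implicit Defensive.

Import Order.TTheory GRing.Theory Num.Theory numFieldNormedType.Exports.

Local Open Scope classical_set_scope.
Local Open Scope ring_scope.

Record sgraph : Type := SGraph {
  vertex :> finType;
  adj : rel vertex;
  adj_sym : symmetric adj;
  adj_irrefl : irreflexive adj
}.

Lemma empty_adj_sym (T : Type) : symmetric (fun _ _ : T => false).
Proof. by []. Qed.

Lemma empty_adj_irrefl (T : Type) : irreflexive (fun _ _ : T => false).
Proof. by []. Qed.

Definition K1 : sgraph :=
  SGraph (@empty_adj_sym unit) (@empty_adj_irrefl unit).

Definition path_adj (m : nat) : rel 'I_m :=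
  fun i j => (i.+1 == j :> nat) || (j.+1 == i :> nat).

Lemma path_adj_sym m : symmetric (@path_adj m).
Proof. by move=> i j; rewrite /path_adj orbC. Qed.

Lemma path_adj_irrefl m : irreflexive (@path_adj m).
Proof. by move=> i; rewrite /path_adj orbb gtn_eqF. Qed.

Definition path_graph (m : nat) : sgraph :=
  SGraph (@path_adj_sym m) (@path_adj_irrefl m).

Definition join_adj (G1 G2 : sgraph) : rel (G1 + G2)%type :=
  fun x y => match x, y with
  | inl a, inl b => adj a b
  | inr a, inr b => adj a b
  | _, _ => true
  end.

Lemma join_adj_sym G1 G2 : symmetric (@join_adj G1 G2).
Proof. by move=> [a|a] [b|b] //=; rewrite adj_sym. Qed.

Lemma join_adj_irrefl G1 G2 : irreflexive (@join_adj G1 G2).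
Proof. by move=> [a|a] /=; rewrite adj_irrefl. Qed.

Definition join_graph (G1 G2 : sgraph) : sgraph :=
  SGraph (@join_adj_sym G1 G2) (@join_adj_irrefl G1 G2).

(* The vertices are listed in the order given by [enum_val]; the spectrum does
   not depend on that choice. *)
Definition adjacency_matrix (R : realType) (G : sgraph) : 'M[R]_#|G| :=
  \matrix_(i, j) (adj (enum_val i) (enum_val j))%:R.

(* The largest modulus of a complex eigenvalue.  [sup] has the junk value 0
   only on the empty spectrum, that is for n = 0. *)
Definition spectral_radius (R : realType) (n : nat) (A : 'M[R]_n) : R :=
  sup [set complex.Re `|z| |
       z in [set z : R[i] | eigenvalue (map_mx (real_complex R) A) z]].

Definition lambda (R : realType) (G : sgraph) : R :=
  spectral_radius (adjacency_matrix R G).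

(* [edge_arc x y], restricted to [0, 1], parametrizes the simple arc that draws the
   edge xy; it is unconstrained when x and y are not adjacent.  Both [edge_arc x y]
   and [edge_arc y x] are given, and they must trace the same set. *)
Record plane_embedding (R : realType) (G : sgraph) : Type := PlaneEmbedding {
  pos : G -> R * R;
  edge_arc : G -> G -> R -> R * R;
  pos_inj : injective pos;
  arc_continuous : forall x y, adj x y ->
    {within `[0, 1], continuous (edge_arc x y)};
  arc_inj : forall x y, adj x y -> {in `[0, 1] &, injective (edge_arc x y)};
  arc_source : forall x y, adj x y -> edge_arc x y 0 = pos x;
  arc_target : forall x y, adj x y -> edge_arc x y 1 = pos y;
  arc_sym : forall x y, adj x y ->
    edge_arc x y @` `[0, 1] = edge_arc y x @` `[0, 1];
  arc_avoids_pos : forall x y z t, adj x y -> t \in `]0, 1[ ->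
    edge_arc x y t <> pos z;
  arc_disjoint : forall x y u v, adj x y -> adj u v ->
    ~~ ((x == u) && (y == v) || (x == v) && (y == u)) ->
    (edge_arc x y @` `]0, 1[) `&` (edge_arc u v @` `]0, 1[) = set0
}.

Definition drawing (R : realType) (G : sgraph) (e : plane_embedding R G) :
    set (R * R) :=
  [set p | (exists x, p = pos e x) \/
           (exists x y t, [/\ adj x y, t \in `[0, 1] & p = edge_arc e x y t])].

Definition face (R : realType) (G : sgraph) (e : plane_embedding R G)
    (F : set (R * R)) : Prop :=
  exists2 p, (~` drawing e) p & F = connected_component (~` drawing e) p.

Definition outer_face (R : realType) (G : sgraph) (e : plane_embedding R G)
    (F : set (R * R)) : Prop :=
  face e F /\ ~ bounded_set F.

Definition boundary (T : topologicalType) (A : set T) : set T :=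
  closure A `\` interior A.

Definition outerplanar (R : realType) (G : sgraph) : Prop :=
  exists (e : plane_embedding R G) (F : set (R * R)),
    outer_face e F /\ forall x : G, boundary F (pos e x).

(* Main.v *)
(* Let p be a point of the outer face of a drawing of an outerplanar graph G.
   Joining p inside the outer face to every vertex turns a K4 minor (resp. a
   K23 minor) of G into a system of continua representing the edges of K5
   (resp. K33), where the continua of disjoint edges are disjoint. This is
   impossible: approximating the continua by chains of points, the chains of
   disjoint edges satisfy the parity relation [crossing_chain], and adding these
   relations over all pairs of disjoint edges gives 0 = 1 modulo 2. So G has
   neither a K4 minor nor a K23 minor.

   Let rho be the spectral radius of G and x >= 0 an eigenvector with maximum
   x_u = 1. If u dominates G, its neighbourhood induces a linear forest and G
   embeds in the fan, the join of K1 and P_(n-1). Otherwise let N be the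
   neighbourhood of u and B the set of vertices at distance at least 2 from u.
   A vertex of N has at most two neighbours in N, and expanding rho^2 x_u gives
     rho^2 - 2 rho <= |N| - 2 / rho + sum_(w in B) d_N(w) x_w.
   When rho >= 5, each component C of G[B] contributes at most |C| - 2/15 to the
   last sum, by the edge bounds for 2-degenerate graphs. The resulting
   inequality is what makes a suitable test vector on the fan have Rayleigh
   quotient at least rho; for n >= 17 such a vector also shows that the spectral
   radius of the fan is at least 5. *)
Require Import Defs.
From mathcomp Require Import all_boot zify.

Set Implicit Arguments.
Unset Strict Implicit.
Unset Printing Implicit Defensive.

(** * Degeneracy and minors *)

(** Connectedness of the subgraph induced by [U]. The empty set qualifies, so nonempty branch sets
    have to come from [gadj]. *)
Definition gconnected (G : sgraph) (U : {set G}) : Prop :=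
  {in U &, forall x y, connect [rel a b | [&& a \in U, b \in U & adj a b]] x y}.

Definition gadj (G : sgraph) (U V : {set G}) : Prop :=
  exists x y, [/\ x \in U, y \in V & adj x y].

Lemma gadjC (G : sgraph) (U V : {set G}) : gadj U V -> gadj V U.
Proof. by move=> [x [y [xU yV xy]]]; exists y, x; rewrite adj_sym. Qed.

Lemma gconnected1 (G : sgraph) (x : G) : gconnected [set x].
Proof. by move=> y z /set1P -> /set1P ->; exact: connect0. Qed.

Lemma gconnectedU (G : sgraph) (U V : {set G}) :
  gconnected U -> gconnected V -> gadj U V -> gconnected (U :|: V).
Proof.
move=> cU cV [x [y [xU yV xy]]].
pose E := [rel a b | [&& a \in U :|: V, b \in U :|: V & adj a b]].
have sE (W : {set G}) : W \subset U :|: V -> gconnected W -> {in W &, forall a b, connect E a b}.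
  move=> /subsetP WUV cW a b aW bW; apply: connect_sub (cW a b aW bW) => c d /= /and3P [cW' dW cd].
  by apply: connect1; rewrite /= cd !WUV.
have symE : connect_sym E.
  by apply: sym_connect_sym => a b; rewrite /= adj_sym andbCA.
have toy a : a \in U :|: V -> connect E a y.
  case/setUP => [aU|aV]; last by apply: sE cV _ _ _ yV; rewrite ?subsetUr.
  apply: connect_trans (sE U (subsetUl _ _) cU a x aU xU) _.
  by apply: connect1; rewrite /= !inE xU yV orbT.
by move=> a b /toy ay /toy; rewrite symE => /(connect_trans ay).
Qed.

Lemma gconnected_path (G : sgraph) (a : G) (s : seq G) :
  path (@adj G) a s -> gconnected [set z in a :: s].
Proof.
elim: s a => [|b s IHs] a /= => [_|/andP [ab /IHs cs]].
  by rewrite set_cons setU0; exact: gconnected1.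
rewrite set_cons; apply: gconnectedU cs _; first exact: gconnected1.
by exists a, b; rewrite !inE !eqxx.
Qed.

Definition K4_minor_free (G : sgraph) : Prop := forall U : 'I_4 -> {set G},
  (forall i, gconnected (U i)) ->
  (forall i j, i != j -> [disjoint U i & U j] /\ gadj (U i) (U j)) -> False.

(** The vertices of degree two are represented by single vertices [x i]: in a K23 minor the rest of
    such a branch set can be absorbed into [A] or [B]. *)
Definition K23_minor_free (G : sgraph) : Prop :=
  forall (A B : {set G}) (x : 'I_3 -> G),
  gconnected A -> gconnected B -> [disjoint A & B] -> injective x ->
  (forall i, [/\ x i \notin A, x i \notin B, gadj A [set x i] & gadj B [set x i]]) ->
  False.

(** The shape in which K4 arises from longest paths: two branch sets are the ends of an edge, the
    other two are arbitrary connected sets. *)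
Lemma K4_minor_free_pattern (G : sgraph) (x y : G) (U V : {set G}) :
  K4_minor_free G -> gconnected U -> gconnected V ->
  x \notin U -> x \notin V -> y \notin U -> y \notin V -> [disjoint U & V] ->
  adj x y -> gadj [set x] U -> gadj [set x] V -> gadj [set y] U -> gadj [set y] V ->
  gadj U V -> False.
Proof.
move=> K4 cU cV xU xV yU yV dUV xy axU axV ayU ayV aUV.
have xny : x != y by apply: contraTneq xy => ->; rewrite adj_irrefl.
have axy : gadj [set x] [set y] by exists x, y; rewrite !inE.
pose W (i : 'I_4) := nth set0 [:: [set x]; [set y]; U; V] i.
suff lt_case (i j : 'I_4) : i < j -> [disjoint W i & W j] /\ gadj (W i) (W j).
  apply: (K4 W) => [i|i j].
    by case: i => [[|[|[|[|]]]] //= i] => //; rewrite /W /=; exact: gconnected1.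
  rewrite -val_eqE neq_ltn => /orP [/lt_case //|/lt_case [d a]].
  by split; [rewrite disjoint_sym|exact: gadjC].
by case: i j => [[|[|[|[|]]]] //= i] [[|[|[|[|]]]] //= j] // _; rewrite /W /=;
  split=> //; rewrite ?disjoints1 ?inE //; exact: gadjC.
Qed.

Definition ndeg (G : sgraph) (Y : {set G}) (x : G) : nat := #|[set y in Y | adj x y]|.

(* Ordered pairs: edges inside X are counted twice in [ecount X X]. *)
Definition ecount (G : sgraph) (X Y : {set G}) : nat := \sum_(x in X) ndeg Y x.

Lemma ndegE (G : sgraph) (Y : {set G}) (x : G) : ndeg Y x = \sum_(y in Y) adj x y.
Proof.
rewrite /ndeg -sum1_card big_mkcond [RHS]big_mkcond /=; apply: eq_bigr => y _.
by rewrite !inE; case: (y \in Y); case: (adj x y).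
Qed.

Lemma ecountC (G : sgraph) (X Y : {set G}) : ecount X Y = ecount Y X.
Proof.
rewrite /ecount; under eq_bigr do rewrite ndegE.
rewrite exchange_big; apply: eq_bigr => y _; rewrite ndegE.
by apply: eq_bigr => x _; rewrite adj_sym.
Qed.

Lemma ecountUl (G : sgraph) (X Y Z : {set G}) :
  [disjoint X & Y] -> ecount (X :|: Y) Z = ecount X Z + ecount Y Z.
Proof.
move=> dXY; rewrite /ecount -bigU //=; apply: eq_bigl => x.
by rewrite !inE.
Qed.

Lemma ecountUr (G : sgraph) (X Y Z : {set G}) :
  [disjoint X & Y] -> ecount Z (X :|: Y) = ecount Z X + ecount Z Y.
Proof. by move=> dXY; rewrite ecountC ecountUl // !(ecountC Z). Qed.

Lemma ecount1l (G : sgraph) (x : G) (Y : {set G}) : ecount [set x] Y = ndeg Y x.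
Proof. by rewrite /ecount big_set1. Qed.

Lemma ndeg_self (G : sgraph) (x : G) : ndeg [set x] x = 0.
Proof. by rewrite ndegE big_set1 adj_irrefl. Qed.

Lemma ndeg_le (G : sgraph) (Y : {set G}) (x : G) : ndeg Y x <= #|Y|.
Proof. by apply: subset_leq_card; apply/subsetP => y; rewrite inE => /andP []. Qed.

Lemma leq_ndeg (G : sgraph) (T U : {set G}) (x : G) : T \subset U -> ndeg T x <= ndeg U x.
Proof.
move=> /subsetP TU; apply: subset_leq_card; apply/subsetP => y.
by rewrite !inE => /andP [/TU -> ->].
Qed.

Lemma ecountD1 (G : sgraph) (S : {set G}) (v : G) : v \in S ->
  ecount S S = ecount (S :\ v) (S :\ v) + 2 * ndeg (S :\ v) v.
Proof.
move=> vS; have dv : [disjoint [set v] & S :\ v] by rewrite disjoints1 !inE eqxx.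
rewrite -{1 2}(setD1K vS) ecountUl // !ecountUr // (ecountC (S :\ v) [set v]).
by rewrite !ecount1l ndeg_self; lia.
Qed.

Lemma ndegD1 (G : sgraph) (S : {set G}) (v : G) : ndeg (S :\ v) v = ndeg S v.
Proof.
rewrite /ndeg; congr #|pred_of_set _|; apply/setP => w; rewrite !inE.
by case: eqP => // ->; rewrite adj_irrefl !andbF.
Qed.

(** Deleting a vertex of degree at most [d] removes at most [d] edges and the last vertex removes
    none, so [S] spans at most [d (|S| - 1)] edges. *)
Lemma ecount_degenerate (G : sgraph) (S : {set G}) (d : nat) :
  (forall T : {set G}, T \subset S -> T != set0 -> exists2 v, v \in T & ndeg T v <= d) ->
  0 < #|S| -> ecount S S + 2 * d <= 2 * d * #|S|.
Proof.
move: {2}#|S| (leqnn #|S|) => k; elim: k S => [|k IHk] S; first by lia.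
move=> Sk dS S0; have [v vS dv] := dS S (subxx _) ltac:(by rewrite -card_gt0).
have cS := cardsD1 v S; rewrite vS in cS.
rewrite (ecountD1 vS) ndegD1.
have [c0|c0] := posnP #|S :\ v|.
  have -> : ecount (S :\ v) (S :\ v) = 0 by rewrite (cards0_eq c0) /ecount big_set0.
  have := ndeg_le (S :\ v) v; rewrite ndegD1; lia.
suff : ecount (S :\ v) (S :\ v) + 2 * d <= 2 * d * #|S :\ v| by nia.
apply: IHk => //; first by lia.
by move=> T TS; apply: dS; exact: subset_trans TS (subsetDl _ _).
Qed.

(** For [d = 2] the deletion stops at two vertices, which span at most one edge; this improves the
    bound to [2 |S| - 3] edges. *)
Lemma ecount_degenerate2 (G : sgraph) (S : {set G}) :
  (forall T : {set G}, T \subset S -> T != set0 -> exists2 v, v \in T & ndeg T v <= 2) ->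
  1 < #|S| -> ecount S S + 6 <= 4 * #|S|.
Proof.
move: {2}#|S| (leqnn #|S|) => k; elim: k S => [|k IHk] S; first by lia.
move=> Sk dS S1; have [v vS dv] := dS S (subxx _) ltac:(by rewrite -card_gt0; lia).
have cS := cardsD1 v S; rewrite vS in cS.
rewrite (ecountD1 vS).
have [c1|c1] := leqP #|S :\ v| 1.
  have /cards1P [w ->] : #|S :\ v| == 1 by lia.
  by have := ndeg_le [set w] v; rewrite ecount1l ndeg_self cards1; lia.
suff : ecount (S :\ v) (S :\ v) + 6 <= 4 * #|S :\ v| by rewrite ndegD1; lia.
apply: IHk => //; first by lia.
by move=> T TS; apply: dS; exact: subset_trans TS (subsetDl _ _).
Qed.

(** * Longest paths and vertices of small degree *)

Definition path_in (G : sgraph) (S : {set G}) (x : G) (s : seq G) : bool :=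
  [&& uniq (x :: s), path (@adj G) x s & all (mem S) (x :: s)].

Definition longest_path_in (G : sgraph) (S : {set G}) (x : G) (s : seq G) : Prop :=
  path_in S x s /\ forall y t, path_in S y t -> size t <= size s.

Lemma longest_path_exists (G : sgraph) (S : {set G}) :
  S != set0 -> exists x s, longest_path_in S x s.
Proof.
move=> /set0Pn [x0 x0S].
(* Tuples of length [n] form a finite type, which makes [P] boolean, as [ex_maxnP] requires. *)
pose P n := [exists x, exists t : n.-tuple G, path_in S x t].
have P0 : exists n, P n.
  exists 0; apply/existsP; exists x0; apply/existsP; exists [tuple].
  by rewrite /path_in /= x0S.
have Pub n : P n -> n <= #|G|.
  move=> /existsP [x /existsP [t /and3P [/card_uniqP ut _ _]]].
  by apply: leq_trans (max_card (mem (x :: t))); rewrite ut /= size_tuple.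
have [n Pn nmax] := ex_maxnP P0 Pub.
move: Pn => /existsP [x /existsP [t pt]]; exists x, t; split=> // y s ps.
rewrite size_tuple; apply: nmax; apply/existsP; exists y.
by apply/existsP; exists (in_tuple s).
Qed.

(** Otherwise [y] could be put in front of the path. *)
Lemma longest_path_neighbour (G : sgraph) (S : {set G}) (x y : G) (s : seq G) :
  longest_path_in S x s -> y \in S -> adj x y -> y \in s.
Proof.
move=> [/and3P [us ps Ss] smax] yS xy; case: (boolP (y \in s)) => // ys.
have := smax y (x :: s); rewrite /path_in /= in us ps Ss *.
rewrite yS adj_sym xy ps Ss us !inE negb_or ys /=.
have -> /= : y != x by apply: contraTneq xy => ->; rewrite adj_irrefl.
by move=> /(_ isT); rewrite ltnn.
Qed.

(* The rotation of a path x A z y B along the edge xy. *)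
Lemma longest_path_rotate (G : sgraph) (S : {set G}) (x y z : G) (A B : seq G) :
  longest_path_in S x (rcons A z ++ y :: B) -> adj x y ->
  longest_path_in S z (rcons (rev A) x ++ y :: B).
Proof.
move=> [/and3P [us ps Ss] smax] xy.
have perm : perm_eq (z :: rcons (rev A) x ++ y :: B) (x :: rcons A z ++ y :: B).
  have e : z :: rcons (rev A) x = rev (x :: rcons A z) by rewrite rev_cons rev_rcons.
  by rewrite -!cat_cons e perm_cat2r perm_rev.
split; last first.
  move=> w t /smax; rewrite !size_cat !size_rcons size_rev; exact.
apply/and3P; split.
- by rewrite (perm_uniq perm).
- move: ps; rewrite !cat_path !last_rcons /= => /and3P [pA _ ->]; rewrite xy !andbT.
  have := rev_path (@adj G) x (rcons A z).
  rewrite last_rcons belast_rcons rev_cons => ->.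
  by under eq_path do rewrite adj_sym.
- by rewrite (perm_all _ perm).
Qed.

Lemma card_gt2_avoid (T : finType) (N : {set T}) (a b : T) :
  2 < #|N| -> exists w, [/\ w \in N, w != a & w != b].
Proof.
move=> N2; have : 0 < #|N :\: [set a; b]|.
  have := cardsID [set a; b] N; have := subset_leq_card (subsetIr N [set a; b]).
  by rewrite cards2; lia.
by move=> /card_gt0P [w]; rewrite !inE negb_or => /andP [/andP [wa wb] wN]; exists w.
Qed.

Lemma mem_behead_split (T : eqType) (s : seq T) (w : T) :
  w \in s -> w != head w s -> exists A z D, s = rcons A z ++ w :: D.
Proof.
case/splitPr => s1 s2; case/lastP: s1 => [|A z] /=; first by rewrite eqxx.
by move=> _; exists A, z, s2.
Qed.

(* Descent on the length of a chord from the end of a longest path: if the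
   chord xy is shortest, then both x and, after rotation, z have a neighbour
   beyond y, and x, y, the arc between them and the part beyond y form a K4. *)
Lemma no_chord (G : sgraph) (S : {set G}) : K4_minor_free G ->
  (forall v, v \in S -> 2 < ndeg S v) ->
  forall A x y z B, longest_path_in S x (rcons A z ++ y :: B) -> adj x y -> False.
Proof.
move=> K4 dS A; have [k] := ubnP (size A); elim: k A => // k IHk A Ak x y z B lp xy.
(* Stated for any longest path with the same tail [y :: B], so that it applies to the given path and
   to its rotation. *)
have beyond A' x' z' : size A' = size A ->
    longest_path_in S x' (rcons A' z' ++ y :: B) -> exists2 w, w \in B & adj x' w.
  move=> sA lp'; have x'S : x' \in S by case: lp' => /and3P [_ _ /andP []].
  have [w []] := card_gt2_avoid (head y (rcons A' z')) y (dS _ x'S).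
  rewrite inE => /andP [wS xw] wh wy.
  have := longest_path_neighbour lp' wS xw.
  rewrite mem_cat inE (negPf wy) /= => /orP [wA|wB]; last by exists w.
  have wh' : w != head w (rcons A' z') by move: wh; case: (A').
  (* A neighbour inside the arc, other than the successor, would end a shorter chord. *)
  exfalso; have [C [z'' [D eA]]] := mem_behead_split wA wh'.
  have := congr1 size eA; rewrite size_cat !size_rcons /= => szA.
  apply: (IHk C _ x' w z'' (D ++ y :: B)); [lia| |by []].
  by move: lp'; rewrite eA -catA.
have [w1 w1B xw1] := beyond A x z erefl lp.
have [w2 w2B zw2] := beyond (rev A) z x (size_rev A) (longest_path_rotate lp xy).
have [/and3P [us ps _] _] := lp.
move: ps; rewrite cat_path last_rcons /= => /and3P [pA zy pB].
move: us; rewrite /= cat_uniq mem_cat !inE !negb_or /=.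
move=> /andP [/and3P [xA xny xB] /and3P [uA /andP [yA AB] /andP [yB uB]]].
move/hasPn: AB => AB.
case: B => [//|b B] in lp w1B w2B pB xB AB yB uB {beyond} *.
(* The two sets are joined by the edge [z w2]; the edges from [x] and [y] to [b :: B] are [x w1] and
   [y b]. *)
apply: (@K4_minor_free_pattern G x y [set v in rcons A z] [set v in b :: B]) => //.
- case: A pA {Ak lp xA uA yA AB} => [|a A] /=; first by move=> _; exact: (gconnected_path (a := z)).
  by move=> /andP [_ pA]; exact: (gconnected_path (a := a)).
- by apply: gconnected_path; move: pB => /= /andP [].
- by rewrite inE.
- by rewrite inE.
- by rewrite inE.
- by rewrite inE.
- rewrite disjoint_sym; apply/pred0P => v /=; apply/negP; rewrite !inE => /andP [vB vA].
  by have /negP := AB v vB; apply.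
- case: A pA {Ak lp xA uA yA AB} => [|a A] /= /andP [xa _].
    by exists x, z; rewrite !inE.
  by exists x, a; split; rewrite ?inE ?eqxx.
- by exists x, w1; rewrite !inE; split=> //.
- by exists y, z; rewrite !inE mem_rcons mem_head adj_sym.
- by exists y, b; move: pB => /= /andP [-> _]; rewrite !inE !eqxx.
- by exists z, w2; rewrite !inE mem_rcons mem_head; split=> //; move: w2B; rewrite inE.
Qed.

(** If all degrees in [S] were at least three, the end of a longest path would have a neighbour
    other than its successor, hence a chord excluded by [no_chord]. *)
Lemma K4_minor_free_degenerate (G : sgraph) (S : {set G}) : K4_minor_free G ->
  S != set0 -> exists2 v, v \in S & ndeg S v <= 2.
Proof.
move=> K4 S0; have [/existsP [v /andP [vS dv]]|] := boolP [exists v, (v \in S) && (ndeg S v <= 2)].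
  by exists v.
rewrite negb_exists => /forallP nS.
have dS v : v \in S -> 2 < ndeg S v by move=> vS; have := nS v; rewrite vS -ltnNge.
have [x [s lp]] := longest_path_exists S0.
have xS : x \in S by case: (lp) => /and3P [_ _ /andP []].
have [w []] := card_gt2_avoid (head x s) x (dS _ xS).
rewrite inE => /andP [wS xw] wh wx.
have ws := longest_path_neighbour lp wS xw.
have wh' : w != head w s by move: ws wh; case: (s).
have [A [z [D es]]] := mem_behead_split ws wh'.
by exfalso; apply: (no_chord K4 dS (A := A) (x := x) (y := w) (z := z) (B := D)); rewrite -?es.
Qed.

(** If all degrees in [S] were at least two, a chord from the end of a longest path would close a
    cycle among the neighbours of [u], and the cycle with [u] contains a K4 minor. So neighbourhoods
    induce forests. *)
Lemma K4_minor_free_neighbours (G : sgraph) (S : {set G}) (u : G) : K4_minor_free G ->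
  {in S, forall v, adj u v} -> S != set0 -> exists2 v, v \in S & ndeg S v <= 1.
Proof.
move=> K4 uS S0; have [/existsP [v /andP [vS dv]]|] := boolP [exists v, (v \in S) && (ndeg S v <= 1)].
  by exists v.
rewrite negb_exists => /forallP nS.
have dS v : v \in S -> 1 < ndeg S v by move=> vS; have := nS v; rewrite vS -ltnNge.
have [x [s lp]] := longest_path_exists S0.
have [/and3P [us ps /= /andP [xS /allP sS]] _] := lp.
have [w]: exists w, [/\ w \in S, adj x w & w != head x s].
  have : 0 < #|[set y in S | adj x y] :\ head x s|.
    by have := cardsD1 (head x s) [set y in S | adj x y]; have := dS x xS; rewrite /ndeg; lia.
  by move=> /card_gt0P [w]; rewrite !inE => /and3P [? ? ?]; exists w.
move=> [wS xw wh]; have ws := longest_path_neighbour lp wS xw.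
have wh' : w != head w s by move: ws wh; case: (s).
have [A [z [D es]]] := mem_behead_split ws wh'.
move: us ps; rewrite es cat_path last_rcons /= => us /and3P [pA zw _].
move: us; rewrite cat_uniq mem_cat !inE !negb_or /=.
move=> /andP [/and3P [xA xnw _] /and3P [uA /andP [wA _] _]].
have AS v : v \in rcons A z -> v \in S by move=> vA; apply: sS; rewrite es mem_cat vA.
have adjA : exists2 a, a \in rcons A z & adj x a.
  by case: A pA {es xA uA wA AS} => [|a A] /= /andP [xa _];
    [exists z|exists a]; rewrite // !inE eqxx.
have [a aA xa] := adjA.
exfalso; apply: (@K4_minor_free_pattern G u x [set w] [set v in rcons A z]) => //.
- exact: gconnected1.
- case: A pA {es xA uA wA AS adjA aA} => [|b A] /=; first by move=> _; exact: (gconnected_path (a := z)).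
  by move=> /andP [_ pA]; exact: (gconnected_path (a := b)).
- by rewrite inE; apply: contraTneq (uS w wS) => ->; rewrite adj_irrefl.
- by rewrite inE; apply/negP => /AS /uS; rewrite adj_irrefl.
- by rewrite inE.
- by rewrite inE.
- by rewrite disjoints1 inE.
- exact: uS.
- by exists u, w; rewrite !inE uS.
- by exists u, a; rewrite !inE uS // AS.
- by exists x, w; rewrite !inE.
- by exists x, a; rewrite !inE.
- by exists w, z; rewrite !inE mem_rcons mem_head adj_sym.
Qed.

(** * Linear forests written as sequences *)

Definition consecutive (T : eqType) (s : seq T) (x y : T) : bool :=
  infix [:: x; y] s || infix [:: y; x] s.

Lemma infix2_cat (T : eqType) (x y : T) (s t : seq T) : infix [:: x; y] (s ++ t) ->
  [\/ infix [:: x; y] s, infix [:: x; y] t |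
      exists s' t', s = rcons s' x /\ t = y :: t'].
Proof.
elim: s => [|a s IHs]; first by constructor 2.
rewrite cat_cons infix_consl => /orP [|/IHs [sI|tI|[s' [t' [-> ->]]]]].
- case: s {IHs} => [|b s]; rewrite /= ?andbT.
    case: t => [|b t]; rewrite ?andbF //= => /and3P [/eqP -> /eqP -> _].
    by constructor 3; exists [::], t.
  by move=> /and3P [/eqP -> /eqP -> _]; constructor 1; rewrite !eqxx prefix0s.
- by constructor 1; rewrite infix_consl sI orbT.
- by constructor 2.
- by constructor 3; exists (a :: s'), t'.
Qed.

Lemma infix_catl (T : eqType) (r s t : seq T) : infix r s -> infix r (s ++ t).
Proof. by move=> /infixP [p [q ->]]; apply/infixP; exists p, (q ++ t); rewrite !catA. Qed.

Lemma infix_catr (T : eqType) (r s t : seq T) : infix r t -> infix r (s ++ t).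
Proof. by move=> /infixP [p [q ->]]; apply/infixP; exists (s ++ p), q; rewrite !catA. Qed.

(** The hypotheses make [S] induce disjoint paths, which can be listed one after the other. In the
    induction a vertex [v] of degree at most one is removed, the rest is arranged, and the list is
    then reordered so that [v] stands beside its neighbour. *)
Lemma linear_forest_arrangement (G : sgraph) (S : {set G}) :
  (forall v, v \in S -> ndeg S v <= 2) ->
  (forall T : {set G}, T \subset S -> T != set0 -> exists2 v, v \in T & ndeg T v <= 1) ->
  exists s : seq G, [/\ uniq s, s =i S & {in S &, forall x y, adj x y -> consecutive s x y}].
Proof.
have [k] := ubnP #|S|; elim: k S => // k IHk S Sk d2 d1.
have [->|S0] := eqVneq S set0.
  by exists [::]; split=> // [x|x y]; rewrite inE.
have [v vS dv] := d1 S (subxx _) S0.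
have cS := cardsD1 v S; rewrite vS in cS.
have [|||s [us sS adjs]] := IHk (S :\ v); first by lia.
- by move=> w; rewrite inE => /andP [_ wS]; apply: leq_trans (leq_ndeg _ (subsetDl _ _)) (d2 w wS).
- by move=> T TS; apply: d1; exact: subset_trans TS (subsetDl _ _).
have vs : v \notin s by rewrite sS !inE eqxx.
suff [t [pt tS vt]] : exists t, [/\ perm_eq t (v :: s),
    (forall x y, x \in s -> y \in s -> adj x y -> consecutive t x y) &
    (forall w, w \in S -> adj v w -> consecutive t v w)].
  have memt : t =i S.
    by move=> x; rewrite (perm_mem pt) inE sS !inE; case: eqP => // ->.
  exists t; split=> //; first by rewrite (perm_uniq pt) /= vs.
  move=> x y xS yS xy; have [xv|xv] := eqVneq x v; first by rewrite xv in xy *; exact: vt.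
  have [yv|yv] := eqVneq y v.
    by rewrite yv in xy *; rewrite /consecutive orbC; apply: vt => //; rewrite adj_sym.
  by apply: tS => //; rewrite sS !inE ?xv ?yv.
have sub x : x \in s -> x \in S by rewrite sS inE => /andP [].
have adj_cons x y : x \in s -> y \in s -> adj x y -> consecutive s x y.
  by rewrite !sS; exact: adjs.
have [w0|] := set_0Vmem [set w in S | adj v w].
  exists (v :: s); split=> // [x y xs ys xy|w wS vw]; last first.
    by have /setP/(_ w) := w0; rewrite !inE wS vw.
  have := adj_cons _ _ xs ys xy; rewrite -cat1s /consecutive.
  by case/orP => /(@infix_catr _ _ [:: v]) ->; rewrite ?orbT.
move=> [w]; rewrite inE => /andP [wS vw].
have only_w w' : w' \in S -> adj v w' -> w' = w.
  move=> w'S vw'; move: dv; rewrite /ndeg => /card_le1P h.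
  have /h/(_ w') : w \in [set y in S | adj v y] by rewrite inE wS.
  by rewrite !inE w'S vw' => /esym/eqP.
have ws : w \in s by rewrite sS !inE wS andbT; apply: contraTneq vw => ->; rewrite adj_irrefl.
case/splitPr: ws sub us vs adj_cons {sS adjs} => s1 s2 sub us vs adj_cons.
(* If the successor of [w] in the list is not a neighbour of [w], cutting the list after [w]
   separates no edge; the two pieces are exchanged and [v] is put after [w]. *)
have [head_adj|head_nadj] := boolP (if s2 is h :: _ then adj w h else false); last first.
  exists (s2 ++ rcons s1 w ++ [:: v]); split.
  - by apply/permP => p; rewrite -cats1 /= !count_cat /=; lia.
  - move=> x y xs ys xy; move: (adj_cons x y xs ys xy) (xy).
    wlog xyI : x y xs ys xy / infix [:: x; y] (s1 ++ w :: s2).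
      move=> hw; case/orP => h; first by apply: hw; rewrite /consecutive ?h.
      by rewrite adj_sym => yx; rewrite /consecutive orbC; apply: hw; rewrite /consecutive ?h.
    move=> _ _; move: xyI; rewrite -cat_rcons => /infix2_cat [h|h|[s' [t' [e1 e2]]]].
    + by rewrite /consecutive infix_catr // infix_catl.
    + by rewrite /consecutive infix_catl.
    + by move: head_nadj e1; rewrite e2 => nwy /rcons_inj [_ ewx]; rewrite ewx xy in nwy.
  - move=> w' w'S vw'; rewrite (only_w _ w'S vw') /consecutive orbC.
    by rewrite infix_catr // -cats1 -catA infix_catr //= !eqxx.
(* Otherwise [v] and the successor are the only neighbours of [w], so the list is cut before [w] and
   [v] is put in front of it. *)
exists ((v :: w :: s2) ++ s1); split.
- by apply/permP => p; rewrite /= !count_cat /=; lia.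
- move=> x y xs ys xy; move: (adj_cons x y xs ys xy) (xy).
  wlog xyI : x y xs ys xy / infix [:: x; y] (s1 ++ w :: s2).
    move=> hw; case/orP => h; first by apply: hw; rewrite /consecutive ?h.
    by rewrite adj_sym => yx; rewrite /consecutive orbC; apply: hw; rewrite /consecutive ?h.
  move=> _ _; move: xyI => /infix2_cat [h|h|[s' [t' [e1 [e2 _]]]]].
  + by rewrite /consecutive infix_catr.
  + by rewrite /consecutive -(cat1s v) -catA infix_catr // infix_catl.
  (* An edge across the cut would give [w] the three neighbours [v], [h] and [x]. *)
  + exfalso; case: s2 head_adj sub us vs {adj_cons xs ys} => [//|h s2] wh sub us vs.
    have := d2 w wS; rewrite leqNgt => /negP; apply.
    have : [set v; h; x] \subset [set z in S | adj w z].
      apply/subsetP => z; rewrite !inE => /orP [/orP [] /eqP ->|/eqP ->].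
      * by rewrite vS adj_sym.
      * by rewrite wh sub // mem_cat !inE eqxx !orbT.
      * by rewrite e2 adj_sym xy sub // e1 mem_cat mem_rcons mem_head.
    move/subset_leq_card; apply: leq_trans.
    rewrite finset.setUC cardsU1 cards2 !inE negb_or.
    move: vs us; rewrite !mem_cat e1 !mem_rcons !inE !negb_or cat_uniq.
    move=> /and4P [/andP [vx _] _ vh _] /and3P [_ /hasPn nh _].
    have -> : x != h.
      by have := nh h; rewrite !inE eqxx orbT mem_rcons inE negb_or => /(_ isT) /andP []; rewrite eq_sym.
    by rewrite eq_sym vx vh.
- move=> w' w'S vw'; rewrite (only_w _ w'S vw') /consecutive.
  by rewrite infix_catl //= !eqxx prefix0s.
Qed.

(** * The neighbourhood of a vertex *)

Definition nbhd (G : sgraph) (u : G) : {set G} := [set v | adj u v].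

Lemma K23_minor_free_pattern (G : sgraph) (A B T : {set G}) : K23_minor_free G ->
  gconnected A -> gconnected B -> [disjoint A & B] ->
  (forall x, x \in T -> [/\ x \notin A, x \notin B, gadj A [set x] & gadj B [set x]]) ->
  #|T| <= 2.
Proof.
move=> K23 cA cB dAB HT; rewrite leqNgt; apply/negP => T3.
apply: (K23 A B (fun i => enum_val (widen_ord T3 i)) cA cB dAB).
  by move=> i j /enum_val_inj /(congr1 val) /= /val_inj.
by move=> i; apply: HT; exact: enum_valP.
Qed.

(** [ndeg (nbhd u) v] counts the common neighbours of [u] and [v]; three of them would form a
    K23. *)
Lemma common_nbhd_le2 (G : sgraph) (u v : G) : K23_minor_free G -> v != u ->
  ndeg (nbhd u) v <= 2.
Proof.
move=> K23 vu; rewrite /ndeg.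
apply: (K23_minor_free_pattern (A := [set u]) (B := [set v]) K23); try exact: gconnected1.
  by rewrite disjoints1 inE eq_sym.
move=> x; rewrite !inE => /andP [ux vx]; split.
- by apply: contraTneq ux => ->; rewrite adj_irrefl.
- by apply: contraTneq vx => ->; rewrite adj_irrefl.
- by exists u, x; rewrite !inE.
- by exists v, x; rewrite !inE.
Qed.

Lemma nbhd_self (G : sgraph) (u : G) : u \notin nbhd u.
Proof. by rewrite inE adj_irrefl. Qed.

Lemma nbhd_arrangement (G : sgraph) (u : G) : K4_minor_free G -> K23_minor_free G ->
  exists s : seq G,
    [/\ uniq s, s =i nbhd u & {in nbhd u &, forall x y, adj x y -> consecutive s x y}].
Proof.
move=> K4 K23; apply: linear_forest_arrangement => [v vN|T /subsetP TN].
  by apply: common_nbhd_le2 => //; apply: contraTneq vN => ->; exact: nbhd_self.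
by apply: (K4_minor_free_neighbours (u := u)) => // v /TN; rewrite inE.
Qed.

Lemma nbhd_ecount (G : sgraph) (u : G) : K4_minor_free G -> 0 < #|nbhd u| ->
  ecount (nbhd u) (nbhd u) + 2 <= 2 * #|nbhd u|.
Proof.
move=> K4 N0; apply: (@ecount_degenerate _ _ 1) => // T /subsetP TN.
by apply: (K4_minor_free_neighbours (u := u)) => // v /TN; rewrite inE.
Qed.

(** [C] stands for a component of the graph induced on the vertices at distance at least two from
    [u]. The last bound is the edge bound for 2-degenerate graphs applied to [C] together with [u]
    and the neighbours of [u] attached to [C]. *)
Lemma component_counts (G : sgraph) (u : G) (C : {set G}) :
  K4_minor_free G -> K23_minor_free G -> gconnected C -> 0 < #|C| -> u \notin C ->
  (forall w, w \in C -> ~~ adj u w) ->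
  (forall w v, w \in C -> adj w v -> v \in C \/ adj u v) ->
  (ecount C C + 6 <= 4 * #|C| \/ #|C| = 1 /\ ecount C C = 0) /\
  ((forall w, w \in C -> ndeg (nbhd u) w <= 1) \/
   exists w0, [/\ w0 \in C, ndeg (nbhd u) w0 = 2,
     forall w, w \in C -> w != w0 -> ndeg (nbhd u) w <= 1 &
     ecount C C + 2 * ecount C (nbhd u) <= 4 * #|C| + 2]).
Proof.
move=> K4 K23 cC C0 uC uCn nC.
have deg2 (S : {set G}) : 1 < #|S| -> ecount S S + 6 <= 4 * #|S|.
  by apply: ecount_degenerate2 => T _; exact: K4_minor_free_degenerate.
split.
  have [C1|C1] := leqP #|C| 1; last by left; exact: deg2.
  right; have /cards1P [w ->] : #|C| == 1 by lia.
  by rewrite cards1 ecount1l ndeg_self.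
have le2 w : w \in C -> ndeg (nbhd u) w <= 2.
  by move=> wC; apply: common_nbhd_le2 => //; apply: contraNneq uC => <-.
have [/existsP [w0 /andP [w0C /eqP dw0]]|] := 
  boolP [exists w, (w \in C) && (ndeg (nbhd u) w == 2)]; last first.
  rewrite negb_exists => /forallP h; left=> w wC.
  by have := h w; rewrite wC /= => h2; have := le2 w wC; lia.
pose att := [set v in nbhd u | [exists w in C, adj v w]].
have attN : att \subset nbhd u by apply/subsetP => v; rewrite inE => /andP [].
have attC v : v \in att -> v \notin C.
  by move=> /(subsetP attN); rewrite inE => uv; apply: contraTN uv; exact: uCn.
have att_edge w v : w \in C -> adj w v -> adj u v -> v \in att.
  by move=> wC wv uv; rewrite !inE uv /=; apply/existsP; exists w; rewrite wC adj_sym.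
(* Three vertices of [att] would form a K23 with [u] and the connected set [C] on the other side. *)
have att2 : #|att| <= 2.
  apply: (K23_minor_free_pattern (A := [set u]) (B := C) K23) => //; first exact: gconnected1.
    by rewrite disjoints1.
  move=> x xatt; have xC := attC x xatt.
  move: xatt; rewrite !inE => /andP [ux /existsP [w /andP [wC xw]]]; split=> //.
  - by apply: contraTneq ux => ->; rewrite adj_irrefl.
  - by exists u, x; rewrite !inE.
  - by exists w, x; rewrite !inE adj_sym.
have ndeg_att w : w \in C -> [set v in nbhd u | adj w v] \subset att.
  move=> wC; apply/subsetP => v; rewrite !inE => /andP [uv wv].
  by have := att_edge w v wC wv uv; rewrite !inE.
have att_eq w : w \in C -> ndeg (nbhd u) w = 2 -> [set v in nbhd u | adj w v] = att.
  by move=> wC dw; apply/eqP; rewrite eqEcard ndeg_att //= -/(ndeg (nbhd u) w) dw.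
right; exists w0; split=> //.
  (* A second such vertex [w] would be adjacent to the same two vertices [a] and [b], whose common
     neighbours [u], [w], [w0] form a K23. *)
  move=> w wC ww0; rewrite leqNgt; apply/negP => dw.
  have {}dw : ndeg (nbhd u) w = 2 by have := le2 w wC; lia.
  have card_att : #|att| = 2 by rewrite -(att_eq w wC dw) -dw.
  have /cards2P [a [b [ab attE]]] : #|att| == 2 by rewrite card_att.
  have natt z : z \in C -> ndeg (nbhd u) z = 2 -> adj z a /\ adj z b.
    move=> zC dz; have := att_eq z zC dz; rewrite attE => /setP e.
    have := e a; have := e b; rewrite !inE !eqxx orbT /=.
    by move=> /andP [_ ->] /andP [_ ->].
  have aatt : a \in att by rewrite attE !inE eqxx.
  have batt : b \in att by rewrite attE !inE eqxx orbT.
  have ua : adj u a by move: (subsetP attN a aatt); rewrite inE.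
  have ub : adj u b by move: (subsetP attN b batt); rewrite inE.
  have [wa wb] := natt w wC dw; have [w0a w0b] := natt w0 w0C dw0.
  have : #|[set u; w; w0]| <= 2.
    apply: (K23_minor_free_pattern (A := [set a]) (B := [set b]) K23); try exact: gconnected1.
      by rewrite disjoints1 inE.
    have key z : adj z a -> adj z b -> [/\ z \notin [set a], z \notin [set b],
        gadj [set a] [set z] & gadj [set b] [set z]].
      move=> za zb; split.
      - by rewrite inE; apply: contraTneq za => ->; rewrite adj_irrefl.
      - by rewrite inE; apply: contraTneq zb => ->; rewrite adj_irrefl.
      - by exists a, z; rewrite !inE adj_sym.
      - by exists b, z; rewrite !inE adj_sym.
    have zab z : z \in [set u; w; w0] -> adj z a /\ adj z b.
      by rewrite !inE => /orP [/orP [] /eqP ->|/eqP ->].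
    by move=> z /zab []; exact: key.
  have -> : [set u; w; w0] = u |: [set w; w0] by rewrite setUA.
  rewrite cardsU1 cards2 !inE ww0 negb_or.
  have -> : u != w by apply: contraNneq uC => ->.
  by have -> : u != w0 by apply: contraNneq uC => ->.
have card_att : #|att| = 2 by rewrite -(att_eq w0 w0C dw0) -dw0.
have uatt : u \notin att by apply: contra (subsetP attN u) _; exact: nbhd_self.
have dua : [disjoint [set u] & att] by rewrite disjoints1.
have dC : [disjoint C & u |: att].
  apply/pred0P => z /=; apply/negP => /andP [zC]; rewrite in_setU1 => /orP [/eqP zu|zatt].
    by rewrite -zu zC in uC.
  by have := attC z zatt; rewrite zC.
(* This set has [|C| + 3] vertices, and the two edges from [u] to [att] count 4 in [ecount], which
   leaves [4 (|C| + 3) - 6 - 4 = 4 |C| + 2]. *)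
have := deg2 (C :|: (u |: att)).
have cardS : #|C :|: (u |: att)| = #|C| + 3.
  by rewrite cardsU (disjoint_setI0 dC) cards0 subn0 cardsU1 uatt card_att.
rewrite cardS ecountUl // !ecountUr // !ecountUl //.
rewrite (ecountC [set u] C) (ecountC att C) (ecountC att [set u]) !ecount1l ndeg_self.
have -> : ndeg att u = 2.
  rewrite -card_att /ndeg; congr #|pred_of_set _|; apply/setP => v.
  by rewrite !inE; case: (adj u v); rewrite ?andbF ?andbT.
have -> : ecount C [set u] = 0.
  rewrite ecountC ecount1l /ndeg; apply/eqP; rewrite cards_eq0; apply/eqP/setP => v.
  by rewrite !inE; apply/negP => /andP [/uCn] /negP.
have -> : ecount C att = ecount C (nbhd u).
  apply: eq_bigr => w wC; rewrite /ndeg; congr #|pred_of_set _|; apply/setP => v.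
  have := ndeg_att w wC; move=> /subsetP /(_ v); rewrite !inE.
  by case: (adj u v) => //=; case: (adj w v) => /=; rewrite ?andbF ?andbT // => ->.
by lia.
Qed.

From mathcomp Require Import all_boot all_order all_algebra.
From mathcomp Require Import all_classical all_reals all_analysis.
From mathcomp Require Import complex lra.
From Stdlib Require Import Ring.

Import Order.TTheory GRing.Theory Num.Theory numFieldNormedType.Exports.

Local Open Scope classical_set_scope.
Local Open Scope ring_scope.

(** * Crossing parity and the nonplanarity of K5 and K33 *)

(** Ties between abscissae are broken by ordinates, so that distinct points are always comparable
    and no general position is assumed. *)
Definition lexlt (R : realType) (u v : R * R) : bool :=
  (u.1 < v.1) || (u.1 == v.1) && (u.2 < v.2).

Lemma lexlt_asym (R : realType) (u v : R * R) :
  u <> v -> lexlt v u = ~~ lexlt u v.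
Proof.
move: u v => [a b] [c d]; rewrite /lexlt /= => neq.
case: (ltgtP a c) => //= eac; case: (ltgtP b d) => //= ebd.
by case: neq; rewrite eac ebd.
Qed.

Definition near_pt (R : realType) (eps : R) (u v : R * R) : bool :=
  (`|u.1 - v.1| < eps) && (`|u.2 - v.2| < eps).

(* Whether the segment [ab] passes above [c]; meaningful only when [c] is far
   from a short segment [ab], so that comparing [c] with [a] is enough. *)
Definition above_seg (R : realType) (a b c : R * R) : bool :=
  xorb (lexlt a c) (lexlt b c) && (c.2 < a.2).

(** The number, modulo 2, of segments of the chain [a :: s] that pass above [c]. *)
Fixpoint above (R : realType) (a : R * R) (s : seq (R * R)) (c : R * R) : bool :=
  if s is b :: s' then xorb (above_seg a b c) (above b s' c) else false.

(** For distinct points: whether exactly one of [a], [b] lies between [c] and [d] in the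
    lexicographic order. *)
Definition interlace (R : realType) (a b c d : R * R) : bool :=
  xorb (xorb (lexlt c a) (lexlt d a)) (xorb (lexlt c b) (lexlt d b)).

(** The parity relation of two disjoint arcs, from [a] to [b] and from [c] to [d], when [P] and [Q]
    count modulo 2 their passages above a point. Both sides are additive under concatenation of
    arcs. *)
Definition crossing_eq (R : realType) (P Q : R * R -> bool) (a b c d : R * R) :=
  xorb (xorb (P c) (P d)) (xorb (Q a) (Q b)) = interlace a b c d.

(** A gap of [3 eps] in one coordinate keeps the two short segments apart in it. If it is the first
    coordinate, all order comparisons agree; if it is the second, only the upper segment can pass
    above the ends of the other, and a boolean identity remains. *)
Lemma crossing_seg (R : realType) (eps : R) (a b c d : R * R) :
  near_pt eps a b -> near_pt eps c d -> ~~ near_pt (3 * eps) a c ->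
  crossing_eq (above_seg a b) (above_seg c d) a b c d.
Proof.
rewrite /crossing_eq /interlace /above_seg /near_pt negb_and -!leNgt.
case/andP=> /ltr_normlP [ab1 ab2] /ltr_normlP [ab3 ab4].
case/andP=> /ltr_normlP [cd1 cd2] /ltr_normlP [cd3 cd4].
have lt_neq (x y : R) : x < y -> [/\ x < y, (y < x) = false, (x == y) = false & (y == x) = false].
  by move=> h; rewrite h; split=> //; [apply: lt_gtF|apply: lt_eqF|apply: gt_eqF].
have lex1 (u v : R * R) : u.1 < v.1 -> lexlt u v = true /\ lexlt v u = false.
  by rewrite /lexlt => /lt_neq [-> -> -> ->].
have lex2 (u v : R * R) : u.2 < v.2 -> lexlt v u = ~~ lexlt u v.
  by move=> h; apply: lexlt_asym => e; move: h; rewrite e ltxx.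
rewrite !ler_normr => /orP [/orP [h|h]|/orP [h|h]].
- have [-> ->] : lexlt c a = true /\ lexlt a c = false by apply: lex1; lra.
  have [-> ->] : lexlt d a = true /\ lexlt a d = false by apply: lex1; lra.
  have [-> ->] : lexlt c b = true /\ lexlt b c = false by apply: lex1; lra.
  by have [-> ->] : lexlt d b = true /\ lexlt b d = false by apply: lex1; lra.
- have [-> ->] : lexlt a c = true /\ lexlt c a = false by apply: lex1; lra.
  have [-> ->] : lexlt a d = true /\ lexlt d a = false by apply: lex1; lra.
  have [-> ->] : lexlt b c = true /\ lexlt c b = false by apply: lex1; lra.
  by have [-> ->] : lexlt b d = true /\ lexlt d b = false by apply: lex1; lra.
- have -> : lexlt a c = ~~ lexlt c a by apply: lex2; lra.
  have -> : lexlt b c = ~~ lexlt c b by apply: lex2; lra.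
  have -> : lexlt a d = ~~ lexlt d a by apply: lex2; lra.
  have -> : lexlt b d = ~~ lexlt d b by apply: lex2; lra.
  have -> : c.2 < a.2 by lra.
  have -> : d.2 < a.2 by lra.
  have -> : (a.2 < c.2) = false by lra.
  have -> : (b.2 < c.2) = false by lra.
  by move: (lexlt c a) (lexlt d a) (lexlt c b) (lexlt d b); do 4!case.
- have -> : (c.2 < a.2) = false by lra.
  have -> : (d.2 < a.2) = false by lra.
  have -> : a.2 < c.2 by lra.
  have -> : b.2 < c.2 by lra.
  by rewrite !andbF !andbT.
Qed.

Lemma crossing_seg_chain (R : realType) (eps : R) (a b c : R * R) (t : seq (R * R)) :
  near_pt eps a b -> path (near_pt eps) c t ->
  (forall q, q \in c :: t -> ~~ near_pt (3 * eps) a q) ->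
  crossing_eq (above_seg a b) (above c t) a b c (last c t).
Proof.
move=> ab; elim: t c => [|d t IHt] c /= => [_ _|/andP [cd pt] far].
  by rewrite /crossing_eq /interlace /=; ring.
have := IHt d pt (fun q hq => far q (@mem_behead _ [:: c, d & t] q hq)).
have := crossing_seg ab cd (far c (mem_head _ _)).
rewrite /crossing_eq /interlace => E1 E2.
(* The interlacing terms telescope at the intermediate point [d]; [ring] works in the boolean ring
   whose addition is [xorb]. *)
rewrite -[RHS](_ : xorb (xorb (xorb (lexlt c a) (lexlt d a)) (xorb (lexlt c b) (lexlt d b)))
  (xorb (xorb (lexlt d a) (lexlt (last d t) a)) (xorb (lexlt d b) (lexlt (last d t) b))) = _).
  by rewrite -E1 -E2; ring.
by ring.
Qed.

Lemma crossing_chain (R : realType) (eps : R) (a c : R * R) (s t : seq (R * R)) :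
  path (near_pt eps) a s -> path (near_pt eps) c t ->
  (forall p q, p \in a :: s -> q \in c :: t -> ~~ near_pt (3 * eps) p q) ->
  crossing_eq (above a s) (above c t) a (last a s) c (last c t).
Proof.
move=> + pt; elim: s a => [|b s IHs] a /= => [_ _|/andP [ab ps] far].
  by rewrite /crossing_eq /interlace /=; ring.
have := IHs b ps (fun p q ph => far p q (@mem_behead _ [:: a, b & s] p ph)).
have := crossing_seg_chain ab pt (fun q => far a q (mem_head _ _)).
rewrite /crossing_eq /interlace => E1 E2.
rewrite -[RHS](_ : xorb
  (xorb (xorb (lexlt c a) (lexlt (last c t) a)) (xorb (lexlt c b) (lexlt (last c t) b)))
  (xorb (xorb (lexlt c b) (lexlt (last c t) b))
        (xorb (lexlt c (last b s)) (lexlt (last c t) (last b s)))) = _).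
  by rewrite -E1 -E2; ring.
by ring.
Qed.

(** The points of [K] that such chains reach from [a] form a subset both open and closed in [K]. *)
Lemma connected_chain (R : realType) (K : set (R * R)) (eps : R) (a b : R * R) :
  connected K -> 0 < eps -> K a -> K b ->
  exists2 s, path (near_pt eps) a s & last a s = b /\ {in a :: s, forall p, K p}.
Proof.
move=> cK eps0 Ka Kb.
pose good q := exists2 s, path (near_pt eps) a s & last a s = q /\ {in a :: s, forall p, K p}.
have step q q' : good q -> K q' -> near_pt eps q q' -> good q'.
  move=> [s ps [ls Ks]] Kq' nq; exists (rcons s q').
    by rewrite rcons_path ps ls.
  by rewrite last_rcons; split=> // p; rewrite -rcons_cons mem_rcons inE => /orP [/eqP ->|/Ks].
have nearE q q' : ball q eps q' <-> near_pt eps q q'.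
  split; first by move=> [/= h1 h2]; rewrite /near_pt h1 h2.
  by move=> /andP [h1 h2]; split.
have good_sub q : good q -> K q by move=> [s _ [<-]]; apply; exact: mem_last.
suff gK : good = K by have : good b by rewrite gK.
apply: (cK good).
- by exists a; exists [::] => //; split=> // p; rewrite inE => /eqP ->.
- exists (\bigcup_(q in good) (ball q eps)°).
    by apply: bigcup_open => q _; exact: open_interior.
  apply/seteqP; split=> q.
    move=> gq; split; first exact: good_sub.
    by exists q => //; exact: nbhsx_ballx.
  move=> [Kq [q' gq' /interior_subset /nearE nq]]; exact: step gq' Kq nq.
- exists (~` \bigcup_(q in K `\` good) (ball q eps)°).
    by apply: open_closedC; apply: bigcup_open => q _; exact: open_interior.
  apply/seteqP; split=> q.
    move=> gq; split; first exact: good_sub.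
    move=> [q' [Kq' ngq'] /interior_subset /nearE nq]; apply: ngq'.
    apply: step gq Kq' _; apply/nearE; apply: ball_sym; exact/nearE.
  move=> [Kq nq]; apply: contrapT => ngq; apply: nq.
  by exists q => //; exact: nbhsx_ballx.
Qed.

(** An eventual property of [eps], so that finitely many pairs can be handled by one [eps];
    compactness of [K] reduces it to a bound near each point. *)
Lemma compact_disjoint_far (R : realType) (K L : set (R * R)) :
  compact K -> compact L -> K `&` L = set0 ->
  \forall eps \near (0 : R)^'+, forall p q, K p -> L q -> ~~ near_pt eps p q.
Proof.
move=> cK cL KL.
have clL : closed L by apply: compact_closed.
suff : \forall eps \near (0 : R)^'+, K `<=` [set p | forall q, L q -> ~~ near_pt eps p q].
  by apply: filterS => eps h p q Kp Lq; apply: h.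
move/compact_near_coveringP: cK => /(_ R (0^'+)) /=.
apply=> p Kp.
have [r /= r0 pr] : exists2 r : R, 0 < r & ball p r `<=` ~` L.
  have : nbhs p (~` L).
    apply: open_nbhs_nbhs; split; first exact: closed_openC.
    by move=> Lp; have : (K `&` L) p by []; rewrite KL.
  by move=> /nbhs_ballP [r r0 pr]; exists r.
exists (ball p (r / 2), [set e | e < r / 2]).
  split; first by apply: nbhsx_ballx; rewrite divr_gt0.
  by apply: nbhs_right_lt; rewrite divr_gt0.
move=> [p' e] /= [pp' er] q Lq; apply/negP => /andP [h1 h2].
apply: (pr q) => //.
rewrite (splitr r); apply: ball_triangle pp' _.
by split => /=; [apply: lt_trans er|apply: lt_trans er].
Qed.

(** One [eps] serves all independent pairs. [W e] is the parity [above] of a single chain chosen for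
    [e]; being the same in every relation, it cancels when the relations are added. *)
Lemma crossing_cochain (R : realType) (I : finType) (E : I -> set (R * R))
    (src tgt : I -> R * R) (indep : rel I) :
  (forall e, compact (E e)) -> (forall e, connected (E e)) ->
  (forall e, E e (src e)) -> (forall e, E e (tgt e)) ->
  (forall e f, indep e f -> E e `&` E f = set0) ->
  exists W : I -> R * R -> bool, forall e f, indep e f ->
    crossing_eq (W e) (W f) (src e) (tgt e) (src f) (tgt f).
Proof.
move=> cE kE Es Et dE.
have far : \forall eps \near (0 : R)^'+, forall ef : I * I, indep ef.1 ef.2 ->
    forall p q, E ef.1 p -> E ef.2 q -> ~~ near_pt eps p q.
  apply: filter_forall => -[e f] /=.
  case: (boolP (indep e f)) => [ief|_]; last exact: nearW.
  by apply: filterS (compact_disjoint_far (cE e) (cE f) (dE _ _ ief)) => eps h _.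
have [eps [eps0 {}far]] : exists eps : R, 0 < eps /\ forall ef : I * I, indep ef.1 ef.2 ->
    forall p q, E ef.1 p -> E ef.2 q -> ~~ near_pt (3 * eps) p q.
  have pos : \forall eps \near (0 : R)^'+, 0 < eps by exact: nbhs_right_gt.
  have [|eps [h1 h2]] := filter_ex (filterI far pos); first exact: at_right_proper_filter. 
  by exists (eps / 3); rewrite divr_gt0 // mulrC divfK.
have ch e := connected_chain (kE e) eps0 (Es e) (Et e).
exists (fun e => above (src e) (projT1 (cid2 (ch e)))) => e f ind.
case: (cid2 (ch e)) (cid2 (ch f)) => [s ps [ls Ks]] [t pt [lt Kt]] /=.
rewrite -ls -lt; apply: crossing_chain ps pt _ => p q /Ks Kp /Kt Kq.
exact: (far (e, f)).
Qed.

(** The relations of the 18 pairs of disjoint edges of K33 are added modulo 2. Each edge-over-vertex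
    term occurs in two of them, so the left side vanishes, while the order terms add up to 1. *)
Lemma K33_parity (wa wb : nat -> nat -> nat -> bool) (laa lab lba lbb : rel nat) :
  (forall i j k l, i < 3 -> j < 3 -> k < 3 -> l < 3 -> i != k -> j != l ->
    xorb (xorb (wa i j k) (wb i j l)) (xorb (wa k l i) (wb k l j)) =
    xorb (xorb (laa k i) (lba l i)) (xorb (lab k j) (lbb l j)))%N ->
  (forall i j, i < j < 3 -> lbb j i = xorb true (lbb i j))%N ->
  (forall i j, i < 3 -> j < 3 -> lba j i = xorb true (lab i j))%N -> False.
Proof.
move=> cr fbb fba; suff : true = false by [].
have := f_equal2 xorb (cr 0%N 0%N 1%N 1%N isT isT isT isT isT isT)
  (f_equal2 xorb (cr 0%N 0%N 1%N 2%N isT isT isT isT isT isT)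
  (f_equal2 xorb (cr 0%N 1%N 1%N 0%N isT isT isT isT isT isT)
  (f_equal2 xorb (cr 0%N 1%N 1%N 2%N isT isT isT isT isT isT)
  (f_equal2 xorb (cr 0%N 2%N 1%N 0%N isT isT isT isT isT isT)
  (f_equal2 xorb (cr 0%N 2%N 1%N 1%N isT isT isT isT isT isT)
  (f_equal2 xorb (cr 0%N 0%N 2%N 1%N isT isT isT isT isT isT)
  (f_equal2 xorb (cr 0%N 0%N 2%N 2%N isT isT isT isT isT isT)
  (f_equal2 xorb (cr 0%N 1%N 2%N 0%N isT isT isT isT isT isT)
  (f_equal2 xorb (cr 0%N 1%N 2%N 2%N isT isT isT isT isT isT)
  (f_equal2 xorb (cr 0%N 2%N 2%N 0%N isT isT isT isT isT isT)
  (f_equal2 xorb (cr 0%N 2%N 2%N 1%N isT isT isT isT isT isT)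
  (f_equal2 xorb (cr 1%N 0%N 2%N 1%N isT isT isT isT isT isT)
  (f_equal2 xorb (cr 1%N 0%N 2%N 2%N isT isT isT isT isT isT)
  (f_equal2 xorb (cr 1%N 1%N 2%N 0%N isT isT isT isT isT isT)
  (f_equal2 xorb (cr 1%N 1%N 2%N 2%N isT isT isT isT isT isT)
  (f_equal2 xorb (cr 1%N 2%N 2%N 0%N isT isT isT isT isT isT)
  (cr 1%N 2%N 2%N 1%N isT isT isT isT isT isT))))))))))))))))).
rewrite [LHS](_ : _ = false); last by ring.
move=> ->; rewrite !fba // (fbb 0 1)%N // (fbb 0 2)%N // (fbb 1 2)%N //.
ring.
Qed.

(** The same sum over the 15 pairs of disjoint edges of K5. Of the three pairings of four ordered
    points exactly one interlaces, and there are five quadruples, so the right side is odd. *)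
Lemma K5_parity (w : nat -> nat -> nat -> bool) (l : rel nat) :
  (forall i j k m, i < j < 5 -> k < m < 5 -> uniq [:: i; j; k; m] ->
    xorb (xorb (w i j k) (w i j m)) (xorb (w k m i) (w k m j)) =
    xorb (xorb (l k i) (l m i)) (xorb (l k j) (l m j)))%N ->
  (forall i j, i < j < 5 -> l j i = xorb true (l i j))%N -> False.
Proof.
move=> cr fl; suff : true = false by [].
have := f_equal2 xorb (cr 0%N 1%N 2%N 3%N isT isT isT)
  (f_equal2 xorb (cr 0%N 2%N 1%N 3%N isT isT isT)
  (f_equal2 xorb (cr 0%N 3%N 1%N 2%N isT isT isT)
  (f_equal2 xorb (cr 0%N 1%N 2%N 4%N isT isT isT)
  (f_equal2 xorb (cr 0%N 2%N 1%N 4%N isT isT isT)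
  (f_equal2 xorb (cr 0%N 4%N 1%N 2%N isT isT isT)
  (f_equal2 xorb (cr 0%N 1%N 3%N 4%N isT isT isT)
  (f_equal2 xorb (cr 0%N 3%N 1%N 4%N isT isT isT)
  (f_equal2 xorb (cr 0%N 4%N 1%N 3%N isT isT isT)
  (f_equal2 xorb (cr 0%N 2%N 3%N 4%N isT isT isT)
  (f_equal2 xorb (cr 0%N 3%N 2%N 4%N isT isT isT)
  (f_equal2 xorb (cr 0%N 4%N 2%N 3%N isT isT isT)
  (f_equal2 xorb (cr 1%N 2%N 3%N 4%N isT isT isT)
  (f_equal2 xorb (cr 1%N 3%N 2%N 4%N isT isT isT)
  (cr 1%N 4%N 2%N 3%N isT isT isT)))))))))))))).
rewrite [LHS](_ : _ = false); last by ring.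
move=> ->; rewrite ?(fl 0 1)%N // ?(fl 0 2)%N // ?(fl 0 3)%N // ?(fl 0 4)%N //
  ?(fl 1 2)%N // ?(fl 1 3)%N // ?(fl 1 4)%N // ?(fl 2 3)%N // ?(fl 2 4)%N // ?(fl 3 4)%N //.
ring.
Qed.

Lemma lexlt_flip (R : realType) (u v : R * R) :
  u <> v -> lexlt v u = xorb true (lexlt u v).
Proof. by move/lexlt_asym ->; case: lexlt. Qed.

Lemma no_K33_sets (R : realType) (E : 'I_3 -> 'I_3 -> set (R * R))
    (a b : 'I_3 -> R * R) :
  (forall i j, compact (E i j)) -> (forall i j, connected (E i j)) ->
  (forall i j, E i j (a i)) -> (forall i j, E i j (b j)) ->
  (forall i j k l, i != k -> j != l -> E i j `&` E k l = set0) -> False.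
Proof.
move=> cE kE Ea Eb dE.
have [||||| W crossW] := @crossing_cochain R ('I_3 * 'I_3)%type (fun e => E e.1 e.2)
  (fun e => a e.1) (fun e => b e.2)
  (fun e f => (e.1 != f.1) && (e.2 != f.2)).
- by move=> e; exact: cE.
- by move=> e; exact: kE.
- by move=> e; exact: Ea.
- by move=> e; exact: Eb.
- by move=> [i j] [k l] /andP [] /=; exact: dE.
pose o (i : nat) : 'I_3 := inord i.
have neq_o i j : (i < 3)%N -> (j < 3)%N -> i != j -> o i != o j.
  by move=> hi hj; apply: contra_neq => /(congr1 (@nat_of_ord 3)); rewrite !inordK.
(* Ends of disjoint edges are distinct points because the continua containing them are disjoint;
   [lexlt_flip] asks for this. *)
have neq (i j k l : 'I_3) p q : i != k -> j != l -> E i j p -> E k l q -> p <> q.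
  move=> ik jl Ep Eq pq; have : (E i j `&` E k l) p by split=> //; rewrite pq.
  by rewrite dE.
have other (i : 'I_3) : exists k, i != k.
  case: (eqVneq i (o 0)) => [->|?]; last by exists (o 0).
  by exists (o 1); apply: neq_o.
apply: (@K33_parity (fun i j k => W (o i, o j) (a (o k)))
  (fun i j k => W (o i, o j) (b (o k)))
  (fun i j => lexlt (a (o i)) (a (o j))) (fun i j => lexlt (a (o i)) (b (o j)))
  (fun i j => lexlt (b (o i)) (a (o j))) (fun i j => lexlt (b (o i)) (b (o j)))).
- move=> i j k l hi hj hk hl ik jl; apply: (crossW (o i, o j) (o k, o l)).
  by rewrite /= !neq_o.
- move=> i j /andP [ij hj]; apply: lexlt_flip.
  apply: (neq (o 0) (o i) (o 1) (o j)); rewrite ?neq_o // ?(ltn_trans ij) //.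
  by rewrite ltn_eqF.
- move=> i j hi hj; apply: lexlt_flip.
  have [k ik] := other (o i); have [l jl] := other (o j).
  by apply: (neq (o i) l k (o j)); rewrite // eq_sym.
Qed.

Lemma no_K5_sets (R : realType) (E : 'I_5 -> 'I_5 -> set (R * R)) (a : 'I_5 -> R * R) :
  (forall i j, compact (E i j)) -> (forall i j, connected (E i j)) ->
  (forall i j, E i j (a i)) -> (forall i j, E i j (a j)) ->
  (forall i j k l, uniq [:: i; j; k; l] -> E i j `&` E k l = set0) -> False.
Proof.
move=> cE kE Ea Eb dE.
have [||||| W crossW] := @crossing_cochain R ('I_5 * 'I_5)%type (fun e => E e.1 e.2)
  (fun e => a e.1) (fun e => a e.2)
  (fun e f => uniq [:: e.1; e.2; f.1; f.2]).
- by move=> e; exact: cE.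
- by move=> e; exact: kE.
- by move=> e; exact: Ea.
- by move=> e; exact: Eb.
- by move=> [i j] [k l] /=; exact: dE.
pose o (i : nat) : 'I_5 := inord i.
have uniq_o s : all (fun i => i < 5)%N s -> uniq s -> uniq (map o s).
  move=> /allP s5 us; rewrite map_inj_in_uniq // => i j /s5 hi /s5 hj.
  by move=> /(congr1 (@nat_of_ord 5)); rewrite !inordK.
apply: (@K5_parity (fun i j k => W (o i, o j) (a (o k))) (fun i j => lexlt (a (o i)) (a (o j)))).
- move=> i j k m /andP [ij hj] /andP [km hm] u; apply: (crossW (o i, o j) (o k, o m)).
  apply: (uniq_o [:: i; j; k; m]) => //=.
  by rewrite hj hm (ltn_trans ij) // (ltn_trans km).
- move=> i j /andP [ij hj]; apply: lexlt_flip.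
  (* Distinct [i] and [j] lie on disjoint edges [i k] and [j l], hence have distinct images. *)
  have [k [l u]] : exists k l, uniq [:: o i; o j; o k; o l].
    have [k [l /andP [kl5 u]]] : exists k l, (all (ltn^~ 5) [:: k; l] && uniq [:: i; j; k; l])%N.
      case: i j ij hj => [|[|[|[|i]]]] [|[|[|[|[|j]]]]] // _ _;
      by [exists 0%N, 1%N|exists 0%N, 2%N|exists 0%N, 3%N
         |exists 1%N, 2%N|exists 1%N, 3%N|exists 2%N, 3%N|exists 3%N, 4%N].
    exists k, l; apply: (uniq_o [:: i; j; k; l]) => //.
    by rewrite /= hj (ltn_trans ij hj); move: kl5; rewrite /=.
  move=> e; have : (E (o i) (o k) `&` E (o j) (o l)) (a (o i)) by split=> //; rewrite e.
  rewrite dE //; move: u; rewrite /= !inE !negb_or (eq_sym (o k) (o j)).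
  by move=> /and4P [/and3P [-> -> ->] /andP [-> ->] -> _].
Qed.

From mathcomp Require Import ring.

(** * Continua in a plane drawing *)

Definition seg_pt (R : realType) (p q : R * R) (t : R) : R * R :=
  ((1 - t) * p.1 + t * q.1, (1 - t) * p.2 + t * q.2).

Definition seg (R : realType) (p q : R * R) : set (R * R) := seg_pt p q @` `[0, 1].

Lemma seg_pt_continuous (R : realType) (p q : R * R) : continuous (seg_pt p q).
Proof.
have cvg_comb (a b t : R) : (1 - s) * a + s * b @[s --> t] --> (1 - t) * a + t * b.
  by apply: cvgD; apply: cvgM; first [exact: cvg_cst|exact: cvg_id|
    apply: cvgB; [exact: cvg_cst|exact: cvg_id]].
move=> t; apply: (@cvg_pair _ _ _ _ (nbhs ((seg_pt p q t).1 : R)) (nbhs ((seg_pt p q t).2 : R)));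
  exact: cvg_comb.
Qed.

Lemma seg_compact (R : realType) (p q : R * R) : compact (seg p q).
Proof.
apply: continuous_compact (@segment_compact _ _ _).
exact/continuous_subspaceT/seg_pt_continuous.
Qed.

Lemma seg_connected (R : realType) (p q : R * R) : connected (seg p q).
Proof.
apply: connected_continuous_connected (@segment_connected _ _ _) _.
exact/continuous_subspaceT/seg_pt_continuous.
Qed.

Lemma seg_pt0 (R : realType) (p q : R * R) : seg_pt p q 0 = p.
Proof. by case: p => a b; rewrite /seg_pt subr0 !mul1r !mul0r !addr0. Qed.

Lemma seg_pt1 (R : realType) (p q : R * R) : seg_pt p q 1 = q.
Proof. by case: q => a b; rewrite /seg_pt subrr !mul1r !mul0r !add0r. Qed.

Lemma seg_source (R : realType) (p q : R * R) : seg p q p.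
Proof. by exists 0; rewrite ?seg_pt0 //= in_itv /= lexx ler01. Qed.

Lemma seg_target (R : realType) (p q : R * R) : seg p q q.
Proof. by exists 1; rewrite ?seg_pt1 //= in_itv /= lexx ler01. Qed.

Lemma seg_ball (R : realType) (p q : R * R) (r : R) : ball p r q -> seg p q `<=` ball p r.
Proof.
move=> [/= h1 h2] _ [t /= /itvP t01 <-].
have key (a b : R) : `|a - b| < r -> `|a - ((1 - t) * a + t * b)| < r.
  move=> ab; rewrite (_ : a - _ = t * (a - b)); last by ring.
  rewrite normrM (ger0_norm (_ : 0 <= t)) ?t01 //; apply: le_lt_trans ab.
  by apply: ler_piMl; rewrite ?t01.
by split; apply: key.
Qed.

Lemma ball_connected (R : realType) (p : R * R) (r : R) : connected (ball p r).
Proof.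
have [r0|r0] := ltP 0 r; last first.
  rewrite (_ : ball p r = set0); first exact: connected0.
  apply/seteqP; split => q //= [/= h _].
  by have := le_lt_trans (normr_ge0 _) (lt_le_trans h r0); rewrite ltxx.
rewrite (_ : ball p r = \bigcup_(q in ball p r) seg p q).
  by apply: bigcup_connected => [|q _]; [exists p => q _; exact: seg_source|exact: seg_connected].
apply/seteqP; split=> q; first by move=> pq; exists q => //; exact: seg_target.
by move=> [q' pq' qq']; exact: seg_ball qq'.
Qed.

(** Balls are connected, so a component contains a small ball around each of its points. *)
Lemma open_component (R : realType) (A : set (R * R)) (p : R * R) :
  open A -> open (connected_component A p).
Proof.
move=> oA; rewrite openE => q cq.
have Aq : A q by exact: connected_component_sub cq.
have [r /= r0 qr] : exists2 r : R, 0 < r & ball q r `<=` A.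
  by have /nbhs_ballP [r r0 qr] : nbhs q A by [exact: open_nbhs_nbhs]; exists r.
apply: (filterS _ (nbhsx_ballx q r r0)).
apply: subset_trans (_ : connected_component A q `<=` _).
  by apply: connected_component_max (@ball_connected _ _ _) => //; exact: ballxx.
by move=> z; exact: connected_component_trans.
Qed.

(** The points joined to [p] by a continuum inside [F] form a subset both open and closed in [F],
    since a continuum can be prolonged by a segment within a ball. *)
Lemma open_connected_continuum (R : realType) (F : set (R * R)) (p q : R * R) :
  open F -> connected F -> F p -> F q ->
  exists K : set (R * R), [/\ compact K, connected K, K `<=` F, K p & K q].
Proof.
move=> oF cF Fp Fq.
pose good q := exists K : set (R * R), [/\ compact K, connected K, K `<=` F, K p & K q].
have good_sub z : good z -> F z by move=> [K [_ _ KF _ Kz]]; exact: KF.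
have step z z' r : good z -> ball z r `<=` F -> ball z r z' -> good z'.
  move=> [K [cK kK KF Kp Kz]] zF zz'; exists (K `|` seg z z'); split.
  - by apply: compactU => //; exact: seg_compact.
  - apply: connectedU => //; last exact: seg_connected.
    by exists z; split=> //; exact: seg_source.
  - by rewrite subUset; split=> //; exact: subset_trans (seg_ball zz') zF.
  - by left.
  - by right; exact: seg_target.
have nb z : F z -> exists2 r : R, 0 < r & ball z r `<=` F.
  move=> Fz; have /nbhs_ballP [r r0 qr] : nbhs z F by exact: open_nbhs_nbhs.
  by exists r.
suff gF : good = F by have : good q by rewrite gF.
apply: (cF good).
- exists p, [set p]; split.
  + exact: compact_set1.
  + exact: connected1.
  + by move=> _ ->.
  + by [].
  + by [].
- exists good; last by apply/seteqP; split=> z => [gz|[]//]; split=> //; exact: good_sub.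
  rewrite openE => z gz; have [r r0 zr] := nb z (good_sub _ gz).
  by apply: (filterS _ (nbhsx_ballx z r r0)) => z'; exact: step gz zr.
- exists (~` (F `\` good)).
    apply: open_closedC; rewrite openE => z [Fz ngz]; have [r r0 zr] := nb z Fz.
    (* With half the radius, the ball around [z'] stays in [F], so a continuum ending at [z'] could
       be prolonged back to [z]. *)
    have r20 : 0 < r / 2 by rewrite divr_gt0.
    apply: (filterS _ (nbhsx_ballx z (r / 2) r20)) => z' zz'; split.
      by apply: zr; apply: le_ball zz'; move: r0 => /= r0; lra.
    move=> gz'; apply: ngz; apply: step gz' _ (ball_sym zz').
    by move=> w z'w; apply: zr; rewrite (splitr r); exact: ball_triangle zz' z'w.
  apply/seteqP; split=> z; first by move=> gz; split; [exact: good_sub|move=> []].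
  by move=> [Fz ngz]; apply: contrapT => gz; apply: ngz.
Qed.

Lemma bigcup_compact_fin (T : topologicalType) (I : finType) (P : pred I) (F : I -> set T) :
  (forall i, P i -> compact (F i)) -> compact (\bigcup_(i in [set i | P i]) F i).
Proof.
move=> cF; rewrite (_ : [set i | P i] = [set` [seq i <- enum I | P i]]).
  rewrite bigcup_seq big_seq; apply: bigsetU_compact => i.
  by rewrite mem_filter => /andP [Pi _]; exact: cF.
by apply/seteqP; split=> i; rewrite /= mem_filter mem_enum andbT.
Qed.

(** * Drawings of induced subgraphs *)

Definition drawn (R : realType) (G : sgraph) (e : plane_embedding R G) (U : {set G}) :
    set (R * R) :=
  \bigcup_(x in [set x | x \in U]) [set pos e x] `|`
  \bigcup_(a in [set a : G * G | [&& a.1 \in U, a.2 \in U & adj a.1 a.2]])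
    (edge_arc e a.1 a.2 @` `[0, 1]).

Lemma drawn_pos (R : realType) (G : sgraph) (e : plane_embedding R G) (U : {set G}) x :
  x \in U -> drawn e U (pos e x).
Proof. by move=> xU; left; exists x. Qed.

Lemma drawn_sub (R : realType) (G : sgraph) (e : plane_embedding R G) (U V : {set G}) :
  U \subset V -> drawn e U `<=` drawn e V.
Proof.
move=> /fintype.subsetP UV p [[x /UV xV ->]|[a /and3P [/UV a1 /UV a2 ad] ap]].
  exact: drawn_pos.
by right; exists a => //; apply/and3P.
Qed.

Lemma drawn_drawing (R : realType) (G : sgraph) (e : plane_embedding R G) (U : {set G}) :
  drawn e U `<=` drawing e.
Proof.
move=> p [[x _ ->]|[[x y] /= /and3P [_ _ xy] [t t01 <-]]]; first by left; exists x.
by right; exists x, y, t.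
Qed.

Lemma drawing_drawn (R : realType) (G : sgraph) (e : plane_embedding R G) :
  drawing e = drawn e [set: G].
Proof.
apply/seteqP; split=> [p|]; last exact: drawn_drawing.
move=> [[x ->]|[x [y [t [xy t01 ->]]]]]; first exact: drawn_pos.
by right; exists (x, y); [rewrite /= !inE|exists t].
Qed.

Lemma drawn_compact (R : realType) (G : sgraph) (e : plane_embedding R G) (U : {set G}) :
  compact (drawn e U).
Proof.
apply: compactU; first by apply: bigcup_compact_fin => x _; exact: compact_set1.
apply: bigcup_compact_fin => a /and3P [_ _ ad].
apply: continuous_compact (@segment_compact _ _ _); exact: arc_continuous.
Qed.

Lemma drawn_connected (R : realType) (G : sgraph) (e : plane_embedding R G) (U : {set G}) :
  gconnected U -> connected (drawn e U).
Proof.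
move=> cU; have [->|[r rU]] := set_0Vmem U.
  rewrite (_ : drawn e finset.set0 = set0); first exact: connected0.
  by apply/seteqP; split=> // p [[x]|[a]]; rewrite /= !inE.
have arc_comp x y : x \in U -> y \in U -> adj x y ->
    connected_component (drawn e U) (pos e r) (pos e x) ->
    edge_arc e x y @` `[0, 1] `<=` connected_component (drawn e U) (pos e r).
  move=> xU yU xy cx; apply: subset_trans (_ : connected_component (drawn e U) (pos e x) `<=` _).
    apply: connected_component_max.
    - by exists 0; [rewrite /= in_itv /= lexx ler01|exact: arc_source].
    - by move=> p xyp; right; exists (x, y) => //; apply/and3P.
    - apply: connected_continuous_connected (@segment_connected _ _ _) _.
      exact: arc_continuous.
  by move=> z; exact: connected_component_trans.
have pos_comp x : x \in U -> connected_component (drawn e U) (pos e r) (pos e x).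
  move=> xU; have /connectP [s rs ->] := cU r x rU xU.
  have : connected_component (drawn e U) (pos e r) (pos e r).
    by apply: connected_component_refl; exact: drawn_pos.
  move: {1 3 5}r rs => z; elim: s z => //= y s IHs z /andP [/and3P [zU yU zy] ys] cz.
  apply: IHs => //; apply: (arc_comp z y zU yU zy cz).
  by exists 1; [rewrite /= in_itv /= lexx ler01|exact: arc_target].
rewrite (_ : drawn e U = connected_component (drawn e U) (pos e r)).
  exact: component_connected.
apply/seteqP; split; last exact: connected_component_sub.
move=> p [[x xU ->]|[[x y] /and3P [/= xU yU xy] xyp]]; first exact: pos_comp.
exact: arc_comp xU yU xy (pos_comp _ xU) _ xyp.
Qed.

Lemma arc_point (R : realType) (G : sgraph) (e : plane_embedding R G) (x y : G) t :
  adj x y -> t \in `[0, 1] ->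
  [\/ edge_arc e x y t = pos e x, edge_arc e x y t = pos e y | t \in `]0, 1[].
Proof.
move=> xy; rewrite in_itv /= => /andP [t0 t1].
have [t00|tn0] := eqVneq t 0; first by apply: Or31; rewrite t00 arc_source.
have [t11|tn1] := eqVneq t 1; first by apply: Or32; rewrite t11 arc_target.
by apply: Or33; rewrite in_itv /= !lt_neqAle t0 t1 tn1 eq_sym tn0.
Qed.

Lemma drawn_posP (R : realType) (G : sgraph) (e : plane_embedding R G) (U : {set G}) x :
  drawn e U (pos e x) -> x \in U.
Proof.
move=> [[y yU /pos_inj ->] //|[[y z] /and3P [/= yU zU yz] [t t01]]].
have [->|->|t01'] := arc_point e yz t01.
- by move=> /pos_inj <-.
- by move=> /pos_inj <-.
- by move=> h; case: (arc_avoids_pos yz t01' h).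
Qed.

(** A common point would be the image of a vertex or interior to two arcs; either way the embedding
    forces a vertex common to [U] and [V]. *)
Lemma drawn_disjoint (R : realType) (G : sgraph) (e : plane_embedding R G) (U V : {set G}) :
  [disjoint U & V]%B -> drawn e U `&` drawn e V = set0.
Proof.
move=> dUV; apply/seteqP; split=> // p [Up Vp].
have noU x : x \in U -> x \in V -> False by move=> xU; rewrite (disjointFr dUV).
case: (Up) => [[x xU px]|[[x y] /and3P [/= xU yU xy] [t t01 tp]]].
  by apply: (noU x) => //; apply: (@drawn_posP R _ e); rewrite -px.
case: (Vp) => [[z zV pz]|[[z w] /and3P [/= zV wV zw] [s s01 sp]]].
  by apply: (noU z) => //; apply: (@drawn_posP R _ e); rewrite -pz.
have [h|h|t01'] := arc_point e xy t01.
- by apply: (noU x) => //; apply: (@drawn_posP R _ e); rewrite -h tp.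
- by apply: (noU y) => //; apply: (@drawn_posP R _ e); rewrite -h tp.
have [h|h|s01'] := arc_point e zw s01.
- by apply: (noU z) => //; apply: (@drawn_posP R _ e); rewrite -h sp.
- by apply: (noU w) => //; apply: (@drawn_posP R _ e); rewrite -h sp.
have neq : ~~ ((x == z) && (y == w) || (x == w) && (y == z)).
  apply/negP => /orP [] /andP [/eqP exz _]; first by apply: (noU x); rewrite // exz.
  by apply: (noU x); rewrite // exz.
have := arc_disjoint e xy zw neq.
by move/seteqP => [/(_ p) h _]; apply: h; split; [exists t|exists s].
Qed.

(* The continua L x play the role of the edges from a new vertex p, placed in
   the outer face, to all the vertices. They may cross the edges at x, which is
   harmless since only disjoint pairs of edges matter for K5 and K33. *)
Lemma outer_fan (R : realType) (G : sgraph) (e : plane_embedding R G) (F : set (R * R)) :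
  outer_face e F -> (forall x, boundary F (pos e x)) ->
  exists (p : R * R) (L : G -> set (R * R)), forall x,
    [/\ compact (L x), connected (L x), L x p, L x (pos e x) &
        forall U : {set G}, x \notin U -> L x `&` drawn e U = set0].
Proof.
move=> [[p dp defF] _] bF; exists p.
have oD : open (~` drawing e).
  by rewrite openC drawing_drawn; apply: compact_closed => //; exact: drawn_compact.
have oF : open F by rewrite defF; exact: open_component.
have cF : connected F by rewrite defF; exact: component_connected.
have Fp : F p by rewrite defF; exact: connected_component_refl.
have FD : F `<=` ~` drawing e by rewrite defF; exact: connected_component_sub.
suff /choice [L HL] : forall x, exists Lx : set (R * R),
    [/\ compact Lx, connected Lx, Lx p, Lx (pos e x) &
        forall U : {set G}, x \notin U -> Lx `&` drawn e U = set0] by exists L.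
move=> x.
(* The drawing of the graph without [x] is compact and misses [pos e x], hence misses a ball around
   it. *)
have [r r0 xr] : exists2 r : R, 0 < r & ball (pos e x) r `<=` ~` drawn e [set~ x].
  have : nbhs (pos e x) (~` drawn e [set~ x]).
    apply: open_nbhs_nbhs; split.
      by rewrite openC; apply: compact_closed => //; exact: drawn_compact.
    by move=> /drawn_posP; rewrite !inE eqxx.
  by move=> /nbhs_ballP [r r0 h]; exists r.
(* Since [pos e x] is a boundary point of [F], the ball contains a point [q] of [F]. The continuum
   goes from [p] to [q] inside [F], then along a segment inside the ball. *)
have [q [Fq xq]] := (bF x).1 _ (nbhsx_ballx (pos e x) r r0).
have [K [cK kK KF Kp Kq]] := open_connected_continuum oF cF Fp Fq.
exists (K `|` seg (pos e x) q); split.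
- by apply: compactU => //; exact: seg_compact.
- apply: connectedU => //; last exact: seg_connected.
  by exists q; split=> //; exact: seg_target.
- by left.
- by right; exact: seg_source.
- move=> U xU; apply/seteqP; split=> // z [[/KF/FD|/(seg_ball xq)/xr] nz Uz]; apply: nz.
    exact: drawn_drawing Uz.
  by apply: drawn_sub Uz; apply/fintype.subsetP => w wU; rewrite !inE; apply: contraNneq xU => <-.
Qed.

(** * Outerplanar graphs exclude K4 and K23 minors *)

(** The four branch sets and the outer point [p] become the vertices of a K5. Two branch sets are
    joined by the drawing of their union, connected because they are adjacent; [p] is joined to a
    branch set by the continuum [L] of one of its vertices. *)
Lemma outerplanar_K4_minor_free (R : realType) (G : sgraph) :
  outerplanar R G -> K4_minor_free G.
Proof.
move=> [e [F [oF bF]]] U cU dU.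
have [p [L HL]] := outer_fan oF bF.
have /choice [x xU] : forall i, exists x, x \in U i.
  move=> i; have [j ij] : exists j : 'I_4, i != j.
    case: (eqVneq i ord0) => [->|?]; last by exists ord0.
    by exists ord_max.
  by have [_ [x [y [xU _ _]]]] := dU i j ij; exists x.
(* [None], the value at [ord_max], stands for [p], and [Some b] for the branch set [U b]. *)
pose u (i : 'I_5) := unlift ord_max i.
pose E (i j : 'I_5) := match u i, u j with
  | Some a, Some b => drawn e (U a :|: U b)
  | Some a, None | None, Some a => L (x a)
  | None, None => [set p]
  end.
pose a (i : 'I_5) := if u i is Some b then pos e (x b) else p.
have dUU (i j k : 'I_4) : i != k -> j != k -> x k \notin U i :|: U j.
  move=> ik jk; rewrite !inE negb_or.
  by rewrite (disjointFl (dU i k ik).1) ?(disjointFl (dU j k jk).1).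
have u_inj i j b : u i = Some b -> u j = Some b -> i = j.
  by rewrite /u; do 2![case: unliftP => // ? -> [->]].
have u_None i j : u i = None -> u j = None -> i = j.
  by rewrite /u; do 2![case: unliftP => // ->].
have neqU i j b c : i != j -> u i = Some b -> u j = Some c -> b != c.
  by move=> ij ui uj; apply: contraNneq ij => bc; apply/eqP; apply: (u_inj i j b); rewrite // bc.
apply: (@no_K5_sets R E a).
- move=> i j; rewrite /E; case: (u i) => [b|]; case: (u j) => [c|].
  + exact: drawn_compact.
  + by have [] := HL (x b).
  + by have [] := HL (x c).
  + exact: compact_set1.
- move=> i j; rewrite /E; case: (u i) => [b|]; case: (u j) => [c|].
  + apply: drawn_connected; have [->|bc] := eqVneq b c; first by rewrite finset.setUid.
    by apply: gconnectedU => //; have [] := dU b c bc.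
  + by have [] := HL (x b).
  + by have [] := HL (x c).
  + exact: connected1.
- move=> i j; rewrite /E /a; case: (u i) => [b|]; case: (u j) => [c|].
  + by apply: drawn_pos; rewrite inE xU.
  + by have [] := HL (x b).
  + by have [] := HL (x c).
  + by [].
- move=> i j; rewrite /E /a; case: (u i) => [b|]; case: (u j) => [c|].
  + by apply: drawn_pos; rewrite inE xU orbT.
  + by have [] := HL (x b).
  + by have [] := HL (x c).
  + by [].
move=> i j k l; rewrite /= !inE !negb_or => /and4P [/and3P [ij ik il] /andP [jk jl] kl _].
have nn (i' j' : 'I_5) : i' != j' -> u i' = None -> u j' = None -> False.
  by move=> ne h1 h2; move: ne; rewrite (u_None _ _ h1 h2) eqxx.
rewrite /E.
(* At most one of the four distinct indices is [None], so five cases remain. *)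
case ui: (u i) => [b|]; case uj: (u j) => [c|]; case uk: (u k) => [b'|]; case ul: (u l) => [c'|];
  try by [exfalso; move: ui uj uk ul; eauto using nn].
- apply: drawn_disjoint; apply/pred0P => z /=; apply/negP => /andP [].
  rewrite !inE => /orP [] z1 /orP [] z2.
  + by move: z2; rewrite (disjointFr (dU _ _ (neqU _ _ _ _ ik ui uk)).1 z1).
  + by move: z2; rewrite (disjointFr (dU _ _ (neqU _ _ _ _ il ui ul)).1 z1).
  + by move: z2; rewrite (disjointFr (dU _ _ (neqU _ _ _ _ jk uj uk)).1 z1).
  + by move: z2; rewrite (disjointFr (dU _ _ (neqU _ _ _ _ jl uj ul)).1 z1).
- rewrite setIC; have [_ _ _ _ ->] := HL (x b') => //.
  by apply: dUU; [exact: neqU ui uk|exact: neqU uj uk].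
- rewrite setIC; have [_ _ _ _ ->] := HL (x c') => //.
  by apply: dUU; [exact: neqU ui ul|exact: neqU uj ul].
- have [_ _ _ _ ->] := HL (x b) => //.
  by apply: dUU; rewrite eq_sym; [exact: neqU ui uk|exact: neqU ui ul].
- have [_ _ _ _ ->] := HL (x c) => //.
  by apply: dUU; rewrite eq_sym; [exact: neqU uj uk|exact: neqU uj ul].
Qed.

(** A K33 of continua with sides [A], [B], [p] and the three vertices [x j]; the edge from [A] or
    [B] to [x j] is the drawing of that set with [x j] added. *)
Lemma outerplanar_K23_minor_free (R : realType) (G : sgraph) :
  outerplanar R G -> K23_minor_free G.
Proof.
move=> [e [F [oF bF]]] A B x cA cB dAB injx HAB.
have [p [L HL]] := outer_fan oF bF.
have [_ _ [a0 [_ [a0A _ _]]] [b0 [_ [b0B _ _]]]] := HAB ord0.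
(* The indices 0, 1, 2 of the first side stand for [A], [B] and [p]. *)
pose S (i : 'I_3) := if i == ord0 then A else B.
pose E (i j : 'I_3) := if i == ord_max then L (x j) else drawn e (x j |: S i).
pose a (i : 'I_3) := if i == ord_max then p else pos e (if i == ord0 then a0 else b0).
apply: (@no_K33_sets R E a (pos e \o x)) => [i j|i j|i j|i j|i j k l ik jl]; rewrite /E /a.
- by case: eqP => _; [have [] := HL (x j)|exact: drawn_compact].
- case: eqP => _; first by have [] := HL (x j).
  have [_ _ aA aB] := HAB j.
  apply: drawn_connected; rewrite finset.setUC; apply: gconnectedU.
  - by rewrite /S; case: eqP.
  - exact: gconnected1.
  - by rewrite /S; case: eqP.
- case: eqP => _; first by have [] := HL (x j).
  by apply: drawn_pos; rewrite /S; case: eqP => _; rewrite !inE ?a0A ?b0B orbT.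
- case: eqP => _; first by have [] := HL (x j).
  by apply: drawn_pos; rewrite !inE eqxx.
have xS (j' i' : 'I_3) : x j' \notin S i' by have [? ?] := HAB j'; rewrite /S; case: eqP.
have xx : x j != x l by apply: contra_neq jl; exact: injx.
case: (eqVneq i ord_max) => [im|nim]; case: (eqVneq k ord_max) => [km|nkm].
- by move: ik; rewrite im km eqxx.
- have [_ _ _ _ ->] := HL (x j) => //.
  by rewrite !inE negb_or xx xS.
- rewrite setIC; have [_ _ _ _ ->] := HL (x l) => //.
  by rewrite !inE negb_or eq_sym xx xS.
- have dS : [disjoint S i & S k]%B.
    rewrite /S; case: (eqVneq i ord0) ik => [->|ni0] ik.
      by rewrite eq_sym (negPf ik).
    have -> : k == ord0.
      move: i k ik nim nkm ni0 => [[|[|[|//]]] hi] [[|[|[|//]]] hk] //.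
    by rewrite disjoint_sym.
  apply: drawn_disjoint; apply/pred0P => z /=; apply/negP => /andP [].
  rewrite !inE => /orP [/eqP ->|z1] /orP [z2|z2].
  - by rewrite (negPf xx) in z2.
  - by rewrite (negPf (xS _ _)) in z2.
  - by rewrite (eqP z2) (negPf (xS _ _)) in z1.
  - by rewrite (disjointFr dS z1) in z2.
Qed.

(** * The fan is outerplanar *)

Lemma seg_ptC (R : realType) (p q : R * R) (t : R) : seg_pt p q t = seg_pt q p (1 - t).
Proof. by rewrite /seg_pt; congr pair; ring. Qed.

Lemma segC_sub (R : realType) (p q : R * R) : seg p q `<=` seg q p.
Proof.
move=> _ [t /= t01 <-]; exists (1 - t); last by rewrite [RHS]seg_ptC.
by move: t01; rewrite /= !in_itv /=; lra.
Qed.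

Lemma seg_pt_inj (R : realType) (p q : R * R) : p <> q -> injective (seg_pt p q).
Proof.
move=> pq s t [e1 e2]; apply: contrapT => st; apply: pq.
have nst : s - t != 0 by rewrite subr_eq0; apply/eqP.
have {}e1 : (s - t) * (q.1 - p.1) = 0 by lra.
have {}e2 : (s - t) * (q.2 - p.2) = 0 by lra.
move/eqP: e1; rewrite mulf_eq0 (negPf nst) /= => /eqP e1.
move/eqP: e2; rewrite mulf_eq0 (negPf nst) /= => /eqP e2.
by rewrite (surjective_pairing p) (surjective_pairing q); congr pair; lra.
Qed.

Definition fan (m : nat) : sgraph := join_graph K1 (path_graph m).

Definition apex {m : nat} : fan m := inl tt.

Definition rim {m : nat} (i : 'I_m) : fan m := inr i.

Definition fan_pos (R : realType) (m : nat) (x : fan m) : R * R :=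
  match x with inl _ => (0, 1) | inr i => (i%:R, 0) end.

Lemma fan_pos_inj (R : realType) (m : nat) : injective (@fan_pos R m).
Proof.
move=> [[]|i] [[]|j] //= [].
- by move=> _ /eqP; rewrite oner_eq0.
- by move=> _ /eqP; rewrite eq_sym oner_eq0.
- by move/eqP; rewrite eqr_nat => /eqP/val_inj ->.
Qed.

Definition fan_arc (R : realType) (m : nat) (x y : fan m) : R -> R * R :=
  seg_pt (fan_pos R x) (fan_pos R y).

(** A normal form independent of the orientation of the edge: a point of a spoke or a point of a rim
    edge. Disjointness of arcs then reduces to comparing coordinates. *)
Lemma fan_arc_interior (R : realType) (m : nat) (x y : fan m) (t : R) :
  adj x y -> t \in `]0, 1[ -> exists2 s : R, s \in `]0, 1[ &
  (exists2 i : 'I_m, fan_arc x y t = (s * i%:R, 1 - s) &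
     x = apex /\ y = rim i \/ x = rim i /\ y = apex) \/
  (exists2 ij : 'I_m * 'I_m, fan_arc x y t = (ij.1%:R + s, 0) &
     ij.2 = ij.1.+1 :> nat /\ (x = rim ij.1 /\ y = rim ij.2 \/ x = rim ij.2 /\ y = rim ij.1)).
Proof.
have t1 : t \in `]0, 1[ -> 1 - t \in `]0, 1[ by rewrite !in_itv /=; lra.
case: x y => [[]|i] [[]|j] //= ad t01.
- exists t => //; left; exists j; last by left.
  by rewrite /fan_arc /seg_pt /=; congr pair; ring.
- exists (1 - t); first exact: t1.
  left; exists i; last by right.
  by rewrite /fan_arc /seg_pt /=; congr pair; ring.
- case/orP: ad => [/eqP ij|/eqP ji].
    exists t => //; right; exists (i, j); last by split=> //; left.
    by rewrite /fan_arc /seg_pt /= -ij -natr1; congr pair; ring.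
  exists (1 - t); first exact: t1.
  right; exists (j, i); last by split=> //; right.
  by rewrite /fan_arc /seg_pt /= -ji -natr1; congr pair; ring.
Qed.

Lemma nat_frac_inj (R : realType) (i j : nat) (s t : R) :
  s \in `]0, 1[ -> t \in `[0, 1[ -> i%:R + s = j%:R + t -> i = j.
Proof.
rewrite !in_itv /= => /andP [s0 s1] /andP [t0 t1] e.
have : (i%:R : R) < j.+1%:R by rewrite -natr1; lra.
have : (j%:R : R) < i.+1%:R by rewrite -natr1; lra.
by rewrite !ltr_nat !ltnS => h1 h2; apply/eqP; rewrite eqn_leq h1 h2.
Qed.

Lemma fan_arc_avoids (R : realType) (m : nat) (x y z : fan m) (t : R) :
  adj x y -> t \in `]0, 1[ -> fan_arc x y t <> fan_pos R z.
Proof.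
move=> xy /(fan_arc_interior xy) [s s01 [[i -> _]|[[i j] /= -> _]]].
  by move: s01; rewrite in_itv /=; case: z => [[]|k] /= s01 []; lra.
case: z => [[]|k] /= [].
  by move=> _ /eqP; rewrite eq_sym oner_eq0.
move=> e; have ik : i = k :> nat.
  by apply: (@nat_frac_inj R _ _ s 0) => //; rewrite ?in_itv /= ?addr0 // lexx ltr01.
by move: s01 e; rewrite ik in_itv /=; lra.
Qed.

Lemma fan_arc_disjoint (R : realType) (m : nat) (x y u v : fan m) :
  adj x y -> adj u v -> ~~ ((x == u) && (y == v) || (x == v) && (y == u)) ->
  (@fan_arc R m x y @` `]0, 1[) `&` (@fan_arc R m u v @` `]0, 1[) = set0.
Proof.
move=> xy uv neq; apply/seteqP; split=> // p [[t t01 tp] [t' t01' tp']].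
have {t01} [s s01 xys] := fan_arc_interior xy t01.
have {t01'} [s' s01' uvs] := fan_arc_interior uv t01'.
move: neq; apply/negP; rewrite negbK.
move: tp' xys uvs; rewrite -tp => -> {tp}.
have itv01 (r : R) : r \in `]0, 1[ -> 0 < r < 1 by rewrite in_itv.
have [s0 s1] := andP (itv01 _ s01); have [s0' s1'] := andP (itv01 _ s01').
move=> [[i -> xyE]|[[i j] /= -> [ij xyE]]] [[i' [] e1 e2 uvE]|[[i' j'] /= [] e1 e2]].
- have es : s = s' by lra.
  have {e1} ii : i = i'.
    apply/val_inj/eqP; rewrite -(eqr_nat R); apply/eqP.
    by apply: (@mulfI _ s); rewrite ?gt_eqF // e1 es.
  by move: xyE uvE; rewrite ii => -[[-> ->]|[-> ->]] [[-> ->]|[-> ->]]; rewrite !eqxx ?orbT.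
- by exfalso; lra.
- by exfalso; lra.
- have [ij' uvE] := e2; have ii : i = i'.
    apply/val_inj; apply: (nat_frac_inj s01 _ e1).
    by rewrite in_itv /= s1' ltW.
  have jj : j = j' by apply: val_inj; rewrite /= ij ij' ii.
  by move: xyE uvE; rewrite ii jj => -[[-> ->]|[-> ->]] [[-> ->]|[-> ->]]; rewrite !eqxx ?orbT.
Qed.

(** The straight-line drawing with the rim on the horizontal axis. It is transparent because the
    next proof computes with its points and arcs. *)
Definition fan_embedding (R : realType) (m : nat) : plane_embedding R (fan m).
Proof.
apply: (@PlaneEmbedding R (fan m) (@fan_pos R m) (@fan_arc R m)).
- exact: fan_pos_inj.
- by move=> x y _; exact/continuous_subspaceT/seg_pt_continuous.
- move=> x y xy s t _ _; apply: seg_pt_inj => /fan_pos_inj exy.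
  by move: xy; rewrite exy adj_irrefl.
- by move=> x y _; exact: seg_pt0.
- by move=> x y _; exact: seg_pt1.
- by move=> x y _; apply/seteqP; split; exact: segC_sub.
- exact: fan_arc_avoids.
- exact: fan_arc_disjoint.
Defined.

(** The drawing lies in the half-strip of points with first coordinate at least 0 and second in
    [[0, 1]]. The complement [O] of the half-strip is connected and unbounded, and reaches the apex
    from above and the rim from below. *)
Lemma fan_outerplanar (R : realType) (m : nat) : outerplanar R (fan m).
Proof.
pose e := fan_embedding R m; exists e.
pose O : set (R * R) := [set p | p.2 < 0] `|` [set p | p.1 < 0] `|` [set p | 1 < p.2].
have posE (x : fan m) : 0 <= (fan_pos R x).1 /\ 0 <= (fan_pos R x).2 <= 1.
  by case: x => [[]|i] /=; rewrite ?ler0n ?lexx ?ler01.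
have O_avoid : O `<=` ~` drawing e.
  move=> p Op [[x px]|[x [y [t [_ /itvP t01 px]]]]]; move: Op; rewrite px.
    by have [? /andP [? ?]] := posE x; move=> [[|]|] /=; lra.
  have [x1 /andP [x2 x3]] := posE x; have [y1 /andP [y2 y3]] := posE y.
  have t0 : 0 <= t by rewrite t01.
  have t1 : 0 <= 1 - t by rewrite subr_ge0 t01.
  have h1 := mulr_ge0 t1 x1; have h2 := mulr_ge0 t0 y1.
  have h3 := mulr_ge0 t1 x2; have h4 := mulr_ge0 t0 y2.
  have h5 := ler_wpM2l t1 x3; have h6 := ler_wpM2l t0 y3.
  by move=> [[|]|] /=; rewrite /fan_arc /seg_pt /=; lra.
have conv_lt (a b c t : R) : 0 <= t -> t <= 1 -> a < c -> b < c -> (1 - t) * a + t * b < c.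
  move=> t0 t1 ac bc; rewrite -subr_gt0.
  rewrite (_ : c - _ = (1 - t) * (c - a) + t * (c - b)); last by ring.
  have [->|tn0] := eqVneq t 0; first by rewrite subr0 mul1r mul0r addr0 subr_gt0.
  apply: ltr_wpDl; first by rewrite mulr_ge0 ?subr_ge0 // ltW.
  by rewrite mulr_gt0 ?subr_gt0 // lt_neqAle eq_sym tn0.
have convex_connected (H : set (R * R)) (c : R * R) : H c ->
    (forall q, H q -> seg c q `<=` H) -> connected H.
  move=> Hc Hs; rewrite (_ : H = \bigcup_(q in H) seg c q).
    apply: bigcup_connected => [|q _]; last exact: seg_connected.
    by exists c => q _; exact: seg_source.
  apply/seteqP; split=> q; first by move=> Hq; exists q => //; exact: seg_target.
  by move=> [q' Hq']; exact: Hs.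
(* Half-planes are connected, and [(-1, -1)] and [(-1, 2)] are points where they overlap. *)
have O_connected : connected O.
  apply: connectedU; [by exists (-1, 2) => /=; split; [right|]; rewrite /=; lra|apply: connectedU|].
  - by exists (-1, -1) => /=; lra.
  - apply: (convex_connected _ (-1, -1)) => [|q q0 _ [t /itvP t01 <-]] /=; first by lra.
    by apply: conv_lt q0; rewrite ?t01 //=; lra.
  - apply: (convex_connected _ (-1, -1)) => [|q q0 _ [t /itvP t01 <-]] /=; first by lra.
    by apply: conv_lt q0; rewrite ?t01 //=; lra.
  - apply: (convex_connected _ (0, 2)) => [|q q0 _ [t /itvP t01 <-]] /=; first by lra.
    rewrite -ltrN2 opprD -!mulrN; apply: conv_lt; rewrite ?t01 //=; first by lra.
    by rewrite ltrN2.
have Op : O (0, -1) by left; left; rewrite /=; lra.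
pose F := connected_component (~` drawing e) (0, -1).
have OF : O `<=` F by apply: connected_component_max.
exists F; split; [split|].
- by exists (0, -1) => //; exact: O_avoid.
- move=> [M [_ HM]].
  have nM := normr_ge0 M; have leM := ler_norm M.
  (* A point of norm [|M| + 2], tested against the bound [|M| + 1], which exceeds [M]. *)
  have Fq : F (0, - (`|M| + 2)) by apply: OF; left; left => /=; lra.
  have /(_ _ Fq) /= := HM (`|M| + 1) ltac:(lra).
  rewrite prod_normE /= normr0 normrN max_r // ger0_norm; first by lra.
  by rewrite addr_ge0.
move=> x; split; last first.
  by move=> /interior_subset/connected_component_sub; apply; left; exists x.
move=> B /nbhs_ballP [r /= r0 rB].
case: x rB => [[]|i] rB.
- exists (0, 1 + r / 2); split; first by apply: OF; right => /=; lra.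
  apply: rB; split => /=; first by rewrite /ball /= subrr normr0.
  by rewrite /ball /= ltr_norml; lra.
- exists (i%:R, - (r / 2)); split; first by apply: OF; left; left => /=; lra.
  apply: rB; split => /=; first by rewrite /ball /= subrr normr0.
  by rewrite /ball /= ltr_norml; lra.
Qed.

(** * Spectral radius of a graph *)

Definition complex_mx (R : realType) (m n : nat) (A : 'M[R]_(m, n)) : 'M[R[i]]_(m, n) :=
  map_mx (real_complex R) A.

Lemma Re_norm (R : realType) (z : R[i]) : (complex.Re `|z|)%:C%C = `|z|.
Proof. by rewrite RRe_real // normr_real. Qed.

Lemma Re_norm_ge0 (R : realType) (z : R[i]) : 0 <= complex.Re `|z|.
Proof. by rewrite -lecR Re_norm normr_ge0. Qed.

(** The spectrum is the finite nonempty list of roots of the characteristic polynomial, so the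
    supremum is a maximum. *)
Lemma spectral_radius_attained (R : realType) (n : nat) (A : 'M[R]_n) : (0 < n)%N ->
  (exists2 z, eigenvalue (complex_mx A) z & complex.Re `|z| = spectral_radius A) /\
  (forall z, eigenvalue (complex_mx A) z -> complex.Re `|z| <= spectral_radius A).
Proof.
move=> n0; have [r rE] : exists r : seq R[i], forall z, eigenvalue (complex_mx A) z = (z \in r).
  have [r pE] := closed_field_poly_normal (char_poly (complex_mx A)); exists r => z.
  by rewrite eigenvalue_root_char pE (monicP (char_poly_monic _)) scale1r root_prod_XsubC.
have [z0 z0r] : exists z0, z0 \in r.
  by have [z0] := eigenvalue_closed (complex_mx A) n0; rewrite rE; exists z0.
have [zm zmr zmax] : exists2 zm, zm \in r & forall z, z \in r -> complex.Re `|z| <= complex.Re `|zm|.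
  elim: r z0 z0r {rE} => // z r IHr z0 _; case: r IHr => [_|z' r IHr].
    by exists z; rewrite ?mem_head // => w; rewrite inE => /eqP ->.
  have [zm zmr zmax] := IHr z' (mem_head _ _).
  have [le|/ltW le] := leP (complex.Re `|z|) (complex.Re `|zm|).
    by exists zm => [|w]; rewrite inE ?zmr ?orbT // => /orP [/eqP ->|/zmax].
  exists z; rewrite ?mem_head // => w; rewrite inE => /orP [/eqP -> //|/zmax wm].
  exact: le_trans wm le.
have radE : spectral_radius A = complex.Re `|zm|.
  apply/eqP; rewrite eq_le; apply/andP; split.
    apply: ge_sup; first by exists (complex.Re `|zm|), zm; rewrite /= ?rE.
    by move=> _ [z /= zr <-]; apply: zmax; rewrite -rE.
  apply: ub_le_sup; last by exists zm; rewrite /= ?rE.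
  by exists (complex.Re `|zm|) => _ [z /= zr <-]; apply: zmax; rewrite -rE.
split; first by exists zm; rewrite ?rE ?radE.
by move=> z; rewrite rE radE; exact: zmax.
Qed.

Lemma real_conj (R : realType) (x : R) : (x%:C%C)^* = x%:C%C.
Proof. by apply: CrealP; rewrite complex_real. Qed.

(** Over the complex numbers [A] is Hermitian. In a unitary eigenbasis the quadratic form becomes a
    sum of [d i |u i|^2], with real eigenvalues [d i] bounded by the spectral radius. *)
Lemma rayleigh_le_spectral_radius (R : realType) (n : nat) (A : 'M[R]_n) (y : 'rV[R]_n) :
  (0 < n)%N -> A^T = A ->
  (y *m A *m y^T) 0 0 <= spectral_radius A * (y *m y^T) 0 0.
Proof.
move=> n0 symA; have [_ radA] := spectral_radius_attained A n0.
pose B := complex_mx A; pose v := complex_mx y.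
have vtC : map_mx Num.conj v^T = v^T.
  by apply/matrixP => i j; rewrite !mxE real_conj.
have hB : B \is hermsymmx.
  apply/is_hermitianmxP; rewrite expr0 scale1r; apply/matrixP => i j.
  by rewrite !mxE real_conj -[in LHS]symA mxE.
have [/orthomx_spectralP BE rd] := (hermitian_normalmx hB, hermitian_spectral_diag_real hB).
set P := spectralmx B in BE; set d := spectral_diag B in BE rd.
have uP : P \is unitarymx := spectral_unitarymx B.
have eig i : eigenvalue B (d 0 i).
  apply/eigenvalueP; exists (row i P).
    rewrite -row_mul BE mulmxA mulmxA mulmxV ?spectral_unit // mul1mx row_mul.
    by rewrite row_diag_mx -scalemxAl -rowE.
  apply/eqP => rP0; have := row_mul i P (invmx P).
  rewrite mulmxV ?spectral_unit // rP0 mul0mx => /rowP /(_ i).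
  by rewrite !mxE eqxx => /eqP; rewrite oner_eq0.
(* The coordinates of [y] in the eigenbasis formed by the rows of [P]. *)
pose u := v *m map_mx Num.conj P^T.
have dE x : (v *m map_mx Num.conj P^T *m x *m P *m v^T) 0 0 = (u *m x *m map_mx Num.conj u^T) 0 0.
  by rewrite /u trmx_mul map_mxM trmxCK vtC !mulmxA.
have LHS_E : ((y *m A *m y^T) 0 0)%:C%C = \sum_i d 0 i * `|u 0 i| ^+ 2.
  transitivity ((v *m B *m v^T) 0 0).
    by rewrite /v /B /complex_mx map_trmx -!map_mxM [RHS]mxE.
  rewrite BE invmx_unitary // !mulmxA dE mxE; apply: eq_bigr => i _.
  rewrite mul_mx_diag !mxE normCK; ring.
have RHS_E : ((y *m y^T) 0 0)%:C%C = \sum_i `|u 0 i| ^+ 2.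
  transitivity ((v *m v^T) 0 0).
    by rewrite /v /complex_mx map_trmx -!map_mxM [RHS]mxE.
  have -> : v *m v^T = u *m 1%:M *m map_mx Num.conj u^T.
    by rewrite /u trmx_mul map_mxM trmxCK vtC !mulmxA mulmx1
      -(mulmxA _ _ P) -(invmx_unitary uP) mulVmx ?unitarymx_unit // mulmx1.
  rewrite mulmx1 mxE; apply: eq_bigr => i _.
  by rewrite !mxE normCK.
rewrite -lecR rmorphM /= LHS_E RHS_E mulr_sumr; apply: ler_sum => i _.
apply: ler_wpM2r; first by rewrite exprn_ge0.
have dr : d 0 i \is Num.real by apply: (mxOverP rd).
by apply: le_trans (real_ler_norm dr) _; rewrite -Re_norm lecR; exact: radA.
Qed.

(** The moduli of the entries of an eigenvector satisfy this by the triangle inequality. *)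
Lemma eigenvalue_modulus_vector (R : realType) (n : nat) (A : 'M[R]_n) (z : R[i]) :
  (forall i j, 0 <= A i j) -> eigenvalue (complex_mx A) z ->
  exists y : 'rV[R]_n, [/\ y != 0, forall j, 0 <= y 0 j &
    forall j, complex.Re `|z| * y 0 j <= (y *m A) 0 j].
Proof.
move=> A0 /eigenvalueP [v vA v0]; exists (\row_j complex.Re `|v 0 j|); split.
- apply: contra_neq v0 => /rowP y0; apply/rowP => j; have := y0 j; rewrite !mxE => vj0.
  by apply/eqP; rewrite -normr_eq0 -Re_norm vj0.
- by move=> j; rewrite mxE Re_norm_ge0.
move=> j; rewrite -lecR rmorphM /= mxE !Re_norm -normrM.
have -> : z * v 0 j = \sum_i v 0 i * (A i j)%:C%C.
  have /rowP/(_ j) := vA; rewrite !mxE => <-.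
  by apply: eq_bigr => i _; rewrite !mxE.
apply: le_trans (ler_norm_sum _ _ _) _; rewrite mxE rmorph_sum /=; apply: ler_sum => i _.
by rewrite mxE rmorphM /= Re_norm normrM [X in _ * X]ger0_norm // ler0c.
Qed.

(* A vector y >= 0 with y A >= rho y attains the maximum of the Rayleigh
   quotient, where the gradient of the quotient vanishes. *)
Lemma rayleigh_extremal (R : realType) (n : nat) (A : 'M[R]_n) (rho : R) (y : 'rV[R]_n) :
  A^T = A -> (forall x : 'rV[R]_n, (x *m A *m x^T) 0 0 <= rho * (x *m x^T) 0 0) ->
  (forall j, 0 <= y 0 j) -> (forall j, rho * y 0 j <= (y *m A) 0 j) ->
  y *m A = rho *: y.
Proof.
move=> symA ray y0 yA; pose g := y *m A - rho *: y.
pose d (a b : 'rV[R]_n) := (a *m b^T) 0 0; pose q (a b : 'rV[R]_n) := (a *m A *m b^T) 0 0.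
have trC (m : 'M[R]_1) : m^T 0 0 = m 0 0 by rewrite mxE.
have qC a b : q a b = q b a by rewrite /q -trC !trmx_mul trmxK symA mulmxA.
have dC a b : d a b = d b a by rewrite /d -trC trmx_mul trmxK.
have dl a b c t : d (a + t *: b) c = d a c + t * d b c.
  by rewrite /d mulmxDl -scalemxAl [LHS]mxE [X in _ + X]mxE.
have ql a b c t : q (a + t *: b) c = q a c + t * q b c.
  by rewrite /q !mulmxDl -!scalemxAl [LHS]mxE [X in _ + X]mxE.
have g0 j : 0 <= g 0 j by rewrite !mxE subr_ge0; have := yA j; rewrite mxE.
have dE a b : d a b = \sum_j a 0 j * b 0 j.
  by rewrite /d mxE; apply: eq_bigr => j _; rewrite !mxE.
have dgg : d g g = q y g - rho * d y g.
  by rewrite {1}/d {1}/g mulmxBl -scalemxAl [LHS]mxE [X in _ + X]mxE [X in - X]mxE.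
have qyy : rho * d y y <= q y y.
  have -> : q y y = d (y *m A) y by [].
  rewrite !dE mulr_sumr; apply: ler_sum => j _; rewrite mulrA.
  by apply: ler_wpM2r.
(* The Rayleigh inequality at [y + t g], after [qyy] has absorbed the terms of order zero. *)
have main t : 2 * t * d g g <= t ^+ 2 * (rho * d g g - q g g).
  have := ray (y + t *: g); rewrite -/(q _ _) -/(d _ _).
  rewrite ql dl (qC y) (qC g) (dC y) (dC g) !ql !dl (qC g y) (dC g y) => h.
  rewrite dgg in h *; nra.
have dgg0 : 0 <= d g g by rewrite dE sumr_ge0 // => j _; rewrite mulr_ge0.
suff /eqP : d g g = 0.
  rewrite dE psumr_eq0; last by move=> j _; rewrite mulr_ge0.
  move/allP => gz; apply/eqP; rewrite -subr_eq0; apply/eqP/rowP => j.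
  by have := gz j (mem_index_enum _); rewrite mulf_eq0 orbb => /eqP ->; rewrite mxE.
apply/eqP; rewrite eq_le dgg0 andbT leNgt; apply/negP => dpos.
set Q := rho * d g g - q g g in main.
have Qpos : 0 < Q by have := main 1; nra.
(* For this [t] the inequality reads [2 s <= s] with [s = (d g g)^2 / Q > 0]. *)
have := main (d g g / Q); rewrite expr2.
rewrite (_ : d g g / Q * (d g g / Q) * Q = d g g / Q * d g g);
  last by rewrite -!mulrA mulVf ?gt_eqF // mulr1 mulrA.
rewrite -mulrA; have : 0 < d g g / Q * d g g by rewrite mulr_gt0 // divr_gt0.
by lra.
Qed.

Lemma adjacency_matrix_sym (R : realType) (G : sgraph) :
  (adjacency_matrix R G)^T = adjacency_matrix R G.
Proof. by apply/matrixP => i j; rewrite !mxE adj_sym. Qed.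

Lemma sum_enum_val (R : realType) (G : sgraph) (F : G -> R) :
  \sum_(i < #|G|) F (enum_val i) = \sum_v F v.
Proof.
rewrite [RHS](reindex (@enum_val G G)) //=.
by apply: onW_bij; exact: enum_val_bij.
Qed.

Lemma lambda_ge (R : realType) (G : sgraph) (x : G -> R) (tau : R) :
  (exists v, x v != 0) ->
  tau * \sum_v x v ^+ 2 <= \sum_v x v * \sum_(w | adj v w) x w -> tau <= lambda R G.
Proof.
move=> [v0 xv0] h; have G0 : (0 < #|G|)%N by apply/card_gt0P; exists v0.
pose y : 'rV[R]_#|G| := \row_i x (enum_val i).
have := rayleigh_le_spectral_radius y G0 (adjacency_matrix_sym R G).
have -> : (y *m y^T) 0 0 = \sum_v x v ^+ 2.
  rewrite mxE -sum_enum_val; apply: eq_bigr => i _; by rewrite !mxE expr2.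
have -> : (y *m adjacency_matrix R G *m y^T) 0 0 = \sum_v x v * \sum_(w | adj v w) x w.
  rewrite mxE -sum_enum_val; apply: eq_bigr => i _; rewrite !mxE mulrC; congr (_ * _).
  rewrite [RHS]big_mkcond -sum_enum_val /=; apply: eq_bigr => j _.
  by rewrite !mxE adj_sym; case: adj; rewrite ?mulr1 ?mulr0.
move=> /(le_trans h); rewrite ler_pM2r // lt_neqAle sumr_ge0 ?andbT; last by move=> v _; rewrite sqr_ge0.
rewrite eq_sym psumr_neq0; last by move=> v _; rewrite sqr_ge0.
by apply/hasP; exists v0; rewrite ?mem_index_enum //= exprn_even_gt0.
Qed.

(** The Perron vector: the moduli of an eigenvector for an eigenvalue of largest modulus give
    [y A >= lambda y], and [rayleigh_extremal] turns this into an equality. *)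
Lemma lambda_eigenvector (R : realType) (G : sgraph) : (0 < #|G|)%N ->
  exists x : G -> R, [/\ forall v, 0 <= x v, exists v, 0 < x v &
    forall v, lambda R G * x v = \sum_(w | adj v w) x w].
Proof.
move=> G0; have [[z ez rad] _] := spectral_radius_attained (adjacency_matrix R G) G0.
have [|y [y0 yge yA]] := eigenvalue_modulus_vector _ ez.
  by move=> i j; rewrite mxE ler0n.
rewrite rad in yA.
have eig := rayleigh_extremal (adjacency_matrix_sym R G)
  (fun x => rayleigh_le_spectral_radius x G0 (adjacency_matrix_sym R G)) yge yA.
exists (fun v => y 0 (enum_rank v)); split=> //.
  have [j yj] : exists j, y 0 j != 0 by apply/rV0Pn.
  by exists (enum_val j); rewrite enum_valK lt_neqAle eq_sym yj yge.
move=> v; have /rowP/(_ (enum_rank v)) := eig; rewrite [RHS]mxE => <-.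
rewrite mxE [RHS]big_mkcond -sum_enum_val /=; apply: eq_bigr => j _.
rewrite mxE enum_rankK enum_valK adj_sym.
by case: adj; rewrite ?mulr1 ?mulr0.
Qed.

(** * Comparison with the fan *)

(** Transported along [phi], the nonnegative eigenvector of [G] is a test vector on [H], which has
    all edges of [G]. *)
Lemma lambda_mono (R : realType) (G H : sgraph) (phi : H -> G) : (0 < #|G|)%N ->
  bijective phi -> (forall a b, adj (phi a) (phi b) -> adj a b) ->
  lambda R G <= lambda R H.
Proof.
move=> G0 bphi sub; have [x [x0 [v xv] eig]] := @lambda_eigenvector R G G0.
have sumE (F : G -> R) : \sum_w F w = \sum_a F (phi a).
  by apply: reindex; apply: onW_bij.
apply: (@lambda_ge _ _ (x \o phi)).
  by have [psi _ psiK] := bphi; exists (psi v); rewrite /= psiK gt_eqF.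
rewrite -(sumE (fun v => x v ^+ 2)) mulr_sumr sumE; apply: ler_sum => a _.
rewrite expr2 mulrCA eig; apply: ler_wpM2l => //.
rewrite big_mkcond [leRHS]big_mkcond sumE /=; apply: ler_sum => b _.
by case: ifP => [/sub ->|_] //; case: ifP.
Qed.

Lemma sum_fan (R : realType) (m : nat) (P : pred (fan m)) (F : fan m -> R) :
  \sum_(v | P v) F v = (if P apex then F apex else 0) + \sum_(i < m | P (rim i)) F (rim i).
Proof.
rewrite big_sumType /=; congr (_ + _).
by rewrite big_mkcond /= (big_pred1 tt) // => -[].
Qed.

Lemma sum_path_adj (R : realType) (m : nat) (f : nat -> R) (i : 'I_m) :
  \sum_(j < m | path_adj i j) f j =
  (if (i.+1 < m)%N then f i.+1 else 0) + (if (0 < i)%N then f i.-1 else 0).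
Proof.
rewrite (bigID (fun j : 'I_m => i.+1 == j :> nat)) /=; congr (_ + _).
  rewrite (eq_bigl (fun j : 'I_m => i.+1 == j :> nat)); last first.
    by move=> j; rewrite /path_adj; lia.
  have [im|im] := ltnP i.+1 m; last by rewrite big1 // => j /eqP ij; have := ltn_ord j; lia.
  by rewrite (big_pred1 (Ordinal im)) // => j; rewrite /= -(inj_eq val_inj) /= eq_sym.
rewrite (eq_bigl (fun j : 'I_m => j.+1 == i :> nat)); last first.
  by move=> j; rewrite /path_adj; lia.
have [i0|i0] := posnP i; first by rewrite big1 // => j /eqP; lia.
have pm : (i.-1 < m)%N by have := ltn_ord i; lia.
rewrite (big_pred1 (Ordinal pm)) // => j; rewrite /= -(inj_eq val_inj) /=; lia.
Qed.

Lemma sum_ord_eq (R : realType) (m k : nat) : (k < m)%N ->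
  \sum_(i < m) ((i == k :> nat)%:R : R) = 1.
Proof.
move=> km; rewrite (bigD1 (Ordinal km)) //= eqxx big1 ?addr0 // => i.
by rewrite -val_eqE /= => /negPf ->.
Qed.

(** The test vector is 1 at the apex, [c] on the inner rim and [e] at both ends of the rim. The
    values solve [tau c = 1 + 2 c] and [tau e = 1 + c], so the eigenvalue equation holds on the rim
    except next to its ends. *)
Lemma fan_lambda_ge (R : realType) (m : nat) (tau : R) : (3 < m)%N -> 2 < tau ->
  tau ^+ 2 - 2 * tau + 2 * (tau - 1) / (tau * (tau - 2)) <= m%:R ->
  tau <= lambda R (fan m).
Proof.
move=> m3 tau2 htau.
have tau0 : tau != 0 by lra.
have tau20 : tau - 2 != 0 by lra.
pose c := (tau - 2)^-1; pose e := (1 + c) / tau.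
pose f (i : nat) := if (i == 0%N) || (i == m.-1) then e else c.
have c0 : 0 < c by rewrite invr_gt0; lra.
have e0 : 0 < e by rewrite divr_gt0; lra.
have tc : tau * c = 1 + 2 * c by rewrite /c; field.
have te : tau * e = 1 + c by rewrite /e; field.
(* The contribution of rim vertex [i] to [x A x - tau x x]; it vanishes except at [1] and [m - 2],
   which are distinct as [3 < m]. *)
pose D (i : nat) : R := c * (e - c) * ((i == 1%N)%:R + (i == m.-2)%:R).
have DE i : (i < m)%N -> D i =
    f i * (1 + ((if (i.+1 < m)%N then f i.+1 else 0) + (if (0 < i)%N then f i.-1 else 0)) - tau * f i).
  move=> im; rewrite /D /f.
  have [->|i0] := eqVneq i 0%N.
    have -> : (0%N == m.-2) = false by lia.
    have -> : (1 < m)%N by lia.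
    have -> : (1%N == m.-1) = false by lia.
    by rewrite /= te; ring.
  have [->|im1] := eqVneq i m.-1.
    have -> : (m.-1 == 1%N) = false by lia.
    have -> : (m.-1 == m.-2) = false by lia.
    have -> : (m.-1.+1 < m)%N = false by lia.
    have -> : (0 < m.-1)%N by lia.
    have -> : (m.-1.-1 == 0%N) = false by lia.
    have -> : (m.-1.-1 == m.-1) = false by lia.
    by rewrite /= te; ring.
  have -> : (i.+1 < m)%N by lia.
  have -> : (0 < i)%N by lia.
  have [->|i1] := eqVneq i 1%N.
    have -> : (1%N == m.-2) = false by lia.
    have -> : (2%N == m.-1) = false by lia.
    by rewrite /= tc; ring.
  have -> : (i.-1 == 0%N) = false by lia.
  have -> : (i.-1 == m.-1) = false by lia.
  have [->|im2] := eqVneq i m.-2.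
    have -> : (m.-2.+1 == m.-1) by lia.
    by rewrite /= tc; ring.
  have -> : (i.+1 == m.-1) = false by lia.
  by rewrite /= tc; ring.
have sumD : \sum_(i < m) D i = 2 * c * (e - c).
  rewrite -mulr_sumr big_split /= !sum_ord_eq; [ring|lia|lia].
have sumf : \sum_(i < m) f i = m%:R * c + 2 * (e - c).
  transitivity (\sum_(i < m) (c + (e - c) * ((i == 0%N :> nat)%:R + (i == m.-1 :> nat)%:R))).
    apply: eq_bigr => i _; rewrite /f; case: (eqVneq (i : nat) 0%N) => [->|_].
      have -> : (0%N == m.-1) = false by lia.
      by rewrite /=; ring.
    by case: eqP => _ /=; ring.
  rewrite big_split /= sumr_const card_ord -mulr_sumr big_split /= !sum_ord_eq; [|lia|lia].
  by rewrite -mulr_natl; ring.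
pose x (v : fan m) : R := if v is inr i then f i else 1.
apply: (@lambda_ge _ _ x); first by exists apex; rewrite oner_neq0.
have -> : \sum_v x v ^+ 2 = 1 + \sum_(i < m) f i ^+ 2 by rewrite sum_fan /= expr1n.
pose s (i : nat) := (if (i.+1 < m)%N then f i.+1 else 0) + (if (0 < i)%N then f i.-1 else 0).
have -> : \sum_v x v * (\sum_(w | adj v w) x w) =
    \sum_(i < m) f i + \sum_(i < m) f i * (1 + s i).
  rewrite sum_fan; congr (_ + _); first by rewrite sum_fan /= add0r mul1r.
  by apply: eq_bigr => i _; rewrite sum_fan /= sum_path_adj.
have : \sum_(i < m) f i * (1 + s i) - tau * \sum_(i < m) f i ^+ 2 = 2 * c * (e - c).
  rewrite -sumD mulr_sumr -sumrB; apply: eq_bigr => i _.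
  by rewrite DE // -/(s i); ring.
have ec : e - c = - (tau * (tau - 2))^-1 by rewrite /e /c; field; rewrite tau0 tau20.
(* Multiplied by [tau - 2], this is exactly the hypothesis on [m]. *)
have mc : tau - 2 * (e - c) - 2 * c * (e - c) <= m%:R * c.
  rewrite ec /c ler_pdivlMr; last by lra.
  apply: le_trans htau; rewrite le_eqVlt; apply/orP; left; apply/eqP.
  by field; rewrite tau0 tau20.
by rewrite sumf; lra.
Qed.

Lemma consecutive_nth (T : eqType) (x0 : T) (s : seq T) (i j : nat) :
  uniq s -> (i < size s)%N -> (j < size s)%N ->
  consecutive s (nth x0 s i) (nth x0 s j) -> (i.+1 == j) || (j.+1 == i).
Proof.
have half k l : uniq s -> (k < size s)%N -> (l < size s)%N ->
    infix [:: nth x0 s k; nth x0 s l] s -> k.+1 == l.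
  move=> us ks ls /infixP [p [q e]].
  rewrite -(index_uniq x0 ks us) -[X in _ == X](index_uniq x0 ls us).
  move: (nth x0 s k) (nth x0 s l) e us {ks ls} => a b -> us.
  move: us; rewrite cat_uniq /= !negb_or ?inE ?negb_or => /and4P [_ /and3P [ap bp _] /andP [ab _] _].
  by rewrite !index_cat (negPf ap) (negPf bp) /= !eqxx (negPf ab) addn0 addn1.
move=> us hi hj /orP [h|h]; first by rewrite (half i j).
by rewrite (half j i) ?orbT.
Qed.

(** The apex is sent to [u] and the rim to the arrangement of its neighbours as a linear forest, so
    every edge of [G] comes from an edge of the fan. *)
Lemma dominating_lambda_le (R : realType) (G : sgraph) (u : G) :
  K4_minor_free G -> K23_minor_free G -> (forall v, v != u -> adj u v) ->
  lambda R G <= lambda R (fan #|G|.-1).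
Proof.
move=> K4 K23 dom; have [s [us sN cs]] := nbhd_arrangement u K4 K23.
have G0 : (0 < #|G|)%N by apply/card_gt0P; exists u.
have szs : size s = #|G|.-1.
  rewrite -(card_uniqP us) (eq_card sN) -(cardC1 u); apply: eq_card => v.
  by rewrite !inE; apply/idP/idP => [uv|/dom //]; apply: contraTneq uv => ->; rewrite adj_irrefl.
pose phi (a : fan #|G|.-1) : G := if a is inr i then nth u s i else u.
have is_lt (i : 'I_#|G|.-1) : (i < size s)%N by rewrite szs.
have in_s (i : 'I_#|G|.-1) : adj u (nth u s i).
  by have : nth u s i \in nbhd u; [rewrite -sN mem_nth|rewrite inE].
apply: (@lambda_mono R G (fan #|G|.-1) phi) => //.
  apply: inj_card_bij; last by rewrite card_sum card_unit card_ord; lia.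
  move=> [[]|i] [[]|j] //= e.
  - by have := in_s j; rewrite -e adj_irrefl.
  - by have := in_s i; rewrite e adj_irrefl.
  - by congr inr; apply/val_inj/eqP; rewrite -(nth_uniq u (is_lt i) (is_lt j) us) e.
move=> [[]|i] [[]|j] //=; first by rewrite adj_irrefl.
move=> ij; apply: (consecutive_nth us (is_lt i) (is_lt j)).
by apply: cs; rewrite ?inE.
Qed.

(** * Estimates around a vertex [u] of maximum weight *)

Section Weights.
Variables (R : realType) (G : sgraph) (rho : R) (x : G -> R) (u : G).
Hypotheses (K4 : K4_minor_free G) (K23 : K23_minor_free G).
Hypotheses (rho5 : 5 <= rho) (x0 : forall v, 0 <= x v) (x1 : forall v, x v <= 1).
Hypothesis (xu : x u = 1).
Hypothesis eig : forall v, rho * x v = \sum_(w | adj v w) x w.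

Lemma sum_adj_in (S : {set G}) (w : G) :
  (forall v, adj w v -> v \in S) -> rho * x w <= (ndeg S w)%:R.
Proof.
move=> wS; rewrite eig; apply: le_trans (_ : \sum_(v | adj w v) 1 <= _).
  by apply: ler_sum => v _.
rewrite sumr_const; rewrite (_ : #|_| = ndeg S w) //; apply: eq_card => v.
by rewrite !inE andb_idl // => /wS.
Qed.

Lemma ndeg_disjointU (A B : {set G}) (w : G) :
  [disjoint A & B]%B -> ndeg (A :|: B) w = (ndeg A w + ndeg B w)%N.
Proof. by move=> dAB; rewrite -!ecount1l ecountUr. Qed.

(** Since [rho >= 5] and weights are at most 1, five times the weight of [C] is at most the sum of
    the degrees of its vertices; [component_counts] bounds these. A vertex [w0] with two neighbours
    in [nbhd u] contributes its weight once more. *)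
Lemma component_sum_le (C : {set G}) :
  gconnected C -> (0 < #|C|)%N -> u \notin C ->
  (forall w, w \in C -> ~~ adj u w) ->
  (forall w v, w \in C -> adj w v -> v \in C \/ adj u v) ->
  \sum_(w in C) (ndeg (nbhd u) w)%:R * x w <= #|C|%:R - 2 / 15.
Proof.
move=> cC C0 uC uCn nC.
have [hE hc] := component_counts K4 K23 cC C0 uC uCn nC.
have dCN : [disjoint C & nbhd u]%B.
  by apply/pred0P => z /=; apply/negP => /andP [/uCn]; rewrite inE => /negP.
have xw w : w \in C -> 5 * x w <= (ndeg C w)%:R + (ndeg (nbhd u) w)%:R.
  move=> wC; rewrite -natrD -ndeg_disjointU //.
  apply: le_trans (_ : rho * x w <= _); first exact: ler_wpM2r.
  by apply: sum_adj_in => v wv; rewrite !inE; case: (nC w v wC wv) => ->; rewrite ?orbT.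
have sumx : 5 * \sum_(w in C) x w <= (ecount C C)%:R + (ecount C (nbhd u))%:R.
  rewrite mulr_sumr /ecount !natr_sum -big_split /=; exact: ler_sum.
case: hc => [le1|[w0 [w0C dw0 le1 E2]]].
  have : \sum_(w in C) (ndeg (nbhd u) w)%:R * x w <= \sum_(w in C) x w.
    by apply: ler_sum => w wC; apply: ler_piMl => //; rewrite lern1 le1.
  have : (ecount C (nbhd u) <= #|C|)%N.
    by rewrite -sum1_card; apply: leq_sum.
  rewrite -(ler_nat R) => h1 h2.
  case: hE => [|[cC1 eC0]]; last by rewrite cC1 eC0 in h1 sumx *; lra.
  by rewrite -(ler_nat R) natrD natrM; lra.
have S_le : \sum_(w in C) (ndeg (nbhd u) w)%:R * x w <= \sum_(w in C) x w + x w0.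
  rewrite (bigD1 w0) //= [X in _ <= X + _](bigD1 w0) //= dw0.
  have : \sum_(i in C | i != w0) (ndeg (nbhd u) i)%:R * x i <= \sum_(i in C | i != w0) x i.
    by apply: ler_sum => w /andP [wC ww0]; apply: ler_piMl => //; rewrite lern1 le1.
  lra.
have G_le : (ecount C (nbhd u) <= #|C| + 1)%N.
  rewrite /ecount -sum1_card (bigD1 w0) //= [X in (_ <= X + _)%N](bigD1 w0) //= dw0.
  have : (\sum_(i in C | i != w0) ndeg (nbhd u) i <= \sum_(i in C | i != w0) 1)%N.
    by apply: leq_sum => w /andP [wC ww0]; exact: le1.
  lia.
have xw0 := xw w0 w0C; have x1w0 := x1 w0.
have d0 : (ndeg C w0 < #|C|)%N.
  by rewrite -ndegD1 (cardsD1 w0 C) w0C ltnS ndeg_le.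
rewrite dw0 -natrD in xw0.
(* Both bounds on [x w0] are kept: [x w0 <= 1], and the degree bound for small [C]. *)
have x0min : 5 * x w0 <= (minn 5 (ndeg C w0 + 2))%:R.
  by rewrite /minn; case: ifP => _ //; lra.
(* Divided by 15, the summand 2 becomes the loss [2 / 15]. *)
have : (3 * (ecount C C + ecount C (nbhd u)) + 3 * minn 5 (ndeg C w0 + 2) + 2 <= 15 * #|C|)%N.
  by lia.
by rewrite -(ler_nat R) !(natrD, natrM); lra.
Qed.

(** [B] splits into the components of its induced subgraph, indexed by their roots; each satisfies
    [component_sum_le]. *)
Lemma far_sum_le (B : {set G}) : B != finset.set0 -> (forall w, (w \in B) = (w != u) && ~~ adj u w) ->
  \sum_(w in B) (ndeg (nbhd u) w)%:R * x w <= #|B|%:R - 2 / 15.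
Proof.
move=> Bn0 BE; pose e := [rel a b | [&& a \in B, b \in B & adj a b]].
have sym_e : connect_sym e by apply: sym_connect_sym => a b; rewrite /= adj_sym andbCA.
pose C r := [set w in B | fingraph.root e w == r].
have comp r : r \in B -> fingraph.root e r = r ->
    \sum_(w in C r) (ndeg (nbhd u) w)%:R * x w <= #|C r|%:R - 2 / 15.
  move=> rB rr; have rC : r \in C r by rewrite inE rB rr eqxx.
  have CE w : w \in C r -> w \in B by rewrite inE => /andP [].
  apply: component_sum_le.
  - move=> a b; rewrite !inE => /andP [aB /eqP ra] /andP [bB rb].
    have /connectP [p] : connect e a b by rewrite -(fingraph.root_connect sym_e) ra eq_sym.
    elim: p a aB ra => [|c p IHp] a aB ra /=; first by move=> _ ->; exact: connect0.
    move=> /andP [/and3P [_ cB ac] cp] bE.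
    have rc : fingraph.root e c = r.
      by rewrite -ra; apply/eqP; rewrite eq_sym (fingraph.root_connect sym_e) connect1 //= aB cB.
    apply: connect_trans (IHp c cB rc cp bE); apply: connect1.
    by rewrite /= !inE aB cB ra rc eqxx.
  - by apply/card_gt0P; exists r.
  - by apply/negP => /CE; rewrite BE eqxx.
  - by move=> w /CE; rewrite BE => /andP [].
  - move=> w v wC wv; have wB := CE w wC; have [uv|nuv] := boolP (adj u v); [by right|left].
    have vB : v \in B.
      rewrite BE nuv andbT; apply: contraTneq wv => ->.
      by move: wB; rewrite BE adj_sym => /andP [].
    move: wC; rewrite !inE vB => /andP [_ /eqP <-] /=.
    by rewrite eq_sym (fingraph.root_connect sym_e) connect1 //= wB vB.
have [b0 b0B] := set0Pn _ Bn0.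
have rootB b : b \in B -> fingraph.root e b \in B.
  move=> bB; have /connectP [p] := connect_root e b.
  case/lastP: p => [|p c]; first by move=> _ ->.
  by rewrite rcons_path last_rcons => /andP [_ /and3P [_ cB _]] ->.
have part (F : G -> R) : \sum_(w in B) F w =
    \sum_(r in B | fingraph.root e r == r) \sum_(w in C r) F w.
  rewrite (partition_big (fingraph.root e) (fun r => (r \in B) && (fingraph.root e r == r))) /=; last first.
    by move=> b bB; rewrite rootB //= root_root // eqxx.
  by apply: eq_bigr => r _; apply: eq_bigl => w; rewrite inE.
rewrite -sum1_card natr_sum !part -lerBlDr opprK.
(* The loss [2 / 15] is kept for the component of [b0] and dropped for the others. *)
rewrite (bigD1 (fingraph.root e b0)) /=; last by rewrite rootB //= root_root // eqxx.
rewrite [X in _ <= X](bigD1 (fingraph.root e b0)) /=; last by rewrite rootB //= root_root // eqxx.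
have := comp (fingraph.root e b0) (rootB _ b0B) (root_root sym_e b0).
rewrite sumr_const -addrAC lerBrDr => h0; apply: lerD => //.
apply: ler_sum => r /andP [/andP [rB /eqP rr] _]; apply: le_trans (comp r rB rr) _.
by rewrite sumr_const; lra.
Qed.

Lemma dominated_or_small : (forall v, v != u -> adj u v) \/
  rho ^+ 2 - 2 * rho + 2 * (rho - 1) / (rho * (rho - 2)) <= #|G|.-1%:R.
Proof.
pose N := nbhd u; pose B : {set G} := [set w | (w != u) && ~~ adj u w]%SET.
have [B0|Bn0] := eqVneq B finset.set0.
  left=> v vu; move/setP/(_ v): B0; rewrite !inE vu /= => /negbFE; exact.
right; have uN : u \notin N := nbhd_self u.
have rho_pos : 0 < rho by apply: lt_le_trans rho5.
have rhoE : rho = \sum_(v in N) x v.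
  by have := eig u; rewrite xu mulr1 => ->; apply: eq_bigl => v; rewrite inE.
have N0 : (0 < #|N|)%N.
  rewrite lt0n; apply/eqP => /cards0_eq N0.
  by move: rhoE; rewrite N0 big_set0; lra.
have card_split : (#|G|.-1 = #|N| + #|B|)%N.
  rewrite -(cardC1 u) -cardsUI (_ : N :&: B = finset.set0) ?cards0 ?addn0; last first.
    by apply/setP => w; rewrite !inE; case: (adj u w); rewrite ?andbF.
  apply: eq_card => w; rewrite !inE.
  have [->|_] := eqVneq w u; first by rewrite adj_irrefl.
  by case: (adj u w).
(* The eigenvalue equation is used at [u] and then at its neighbours: this counts weighted walks of
   length two from [u]. *)
have rho2 : rho ^+ 2 = \sum_w (ndeg N w)%:R * x w.
  rewrite expr2 {2}rhoE mulr_sumr.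
  transitivity (\sum_(v in N) \sum_w (adj v w)%:R * x w).
    apply: eq_bigr => v _; rewrite eig big_mkcond; apply: eq_bigr => w _.
    by case: adj; rewrite ?mul1r ?mul0r.
  rewrite exchange_big; apply: eq_bigr => w _; rewrite -mulr_suml; congr (_ * _).
  by rewrite ndegE natr_sum; apply: eq_bigr => v _; rewrite adj_sym.
have split3 : \sum_w (ndeg N w)%:R * x w = #|N|%:R +
    \sum_(w in N) (ndeg N w)%:R * x w + \sum_(w in B) (ndeg N w)%:R * x w.
  rewrite (bigD1 u) //= xu mulr1 -addrA; congr (_ + _).
    congr (_%:R); apply: eq_card => v; rewrite !inE; exact: andbb.
  rewrite (bigID (mem N)) /=; congr (_ + _); apply: eq_bigl => w; rewrite !inE.
    by have [->|] := eqVneq w u; rewrite ?adj_irrefl //= andbT.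
  by [].
(* On [N] the weights add up to [rho], each is at least [1 / rho], and the deficiencies
   [2 - ndeg N w] are nonnegative with total at least 2, as [N] induces a forest. *)
have sumN : \sum_(w in N) (ndeg N w)%:R * x w <= 2 * rho - 2 / rho.
  have xN w : w \in N -> rho^-1 <= x w.
    rewrite inE => uw; rewrite -[rho^-1]mul1r ler_pdivrMr // mulrC eig -xu.
    by rewrite (bigD1 u) /=; [rewrite lerDl sumr_ge0|rewrite adj_sym].
  have n2 w : w \in N -> (ndeg N w <= 2)%N.
    by move=> wN; apply: common_nbhd_le2 => //; apply: contraNneq uN => <-.
  have : \sum_(w in N) (2 - (ndeg N w)%:R) * rho^-1 <= \sum_(w in N) (2 - (ndeg N w)%:R) * x w.
    apply: ler_sum => w wN; apply: ler_wpM2l; last exact: xN.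
    by rewrite subr_ge0 ler_nat n2.
  have -> : \sum_(w in N) (2 - (ndeg N w)%:R) * x w = 2 * rho - \sum_(w in N) (ndeg N w)%:R * x w.
    by rewrite {1}rhoE mulr_sumr -sumrB; apply: eq_bigr => w _; rewrite mulrBl.
  rewrite -mulr_suml sumrB sumr_const -natr_sum -/(ecount N N).
  have : 2 <= 2 *+ #|N| - (ecount N N)%:R :> R.
    by have := nbhd_ecount K4 N0; rewrite -(ler_nat R) natrD natrM -mulr_natr; lra.
  move=> h1; have := ler_wpM2r (ltW (_ : 0 < rho^-1)) h1; rewrite invr_gt0 => /(_ rho_pos).
  by lra.
have BE w : (w \in B) = (w != u) && ~~ adj u w by rewrite inE.
have sumB := far_sum_le Bn0 BE.
(* Here the constant [2 / 15] is fixed: the left side equals [2 / rho + 2 / (rho (rho - 2))], and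
   [rho (rho - 2) >= 15] when [rho >= 5]. *)
have rr : 2 * (rho - 1) / (rho * (rho - 2)) <= 2 / rho + 2 / 15.
  have r5 := rho5; have rho2_pos : 0 < rho - 2 by lra.
  have h : 15 <= rho * (rho - 2) by nra.
  have h2 : (rho * (rho - 2))^-1 <= 15^-1 by rewrite lef_pV2 ?posrE //; nra.
  rewrite (_ : 2 * (rho - 1) / (rho * (rho - 2)) = 2 / rho + 2 * (rho * (rho - 2))^-1); first by lra.
  by field; rewrite !gt_eqF.
by rewrite card_split natrD rho2 split3; lra.
Qed.
End Weights.

Theorem theorem2 (R : realType) (n : nat) (hn : (17 <= n)%N) :
  outerplanar R (join_graph K1 (path_graph n.-1)) /\
  (forall G : sgraph, #|G| = n -> outerplanar R G ->
     (lambda R G <= lambda R (join_graph K1 (path_graph n.-1)))%R).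
Proof.
split; first exact: fan_outerplanar.
move=> G cG opG; rewrite -/(fan n.-1).
have K4 := outerplanar_K4_minor_free opG.
have K23 := outerplanar_K23_minor_free opG.
have n16 : (16 : R) <= n.-1%:R by rewrite ler_nat; lia.
(* If [lambda R G < 5], the fan already has spectral radius at least 5: for [tau = 5] the condition
   is [15 + 8 / 15 <= n - 1], which holds because [n >= 17]. *)
have [rho5|rho5] := leP 5 (lambda R G); last first.
  apply: le_trans (ltW rho5) _; apply: fan_lambda_ge; [lia|lra|].
  apply: le_trans n16; rewrite (_ : 5 * (5 - 2) = 15); last by ring.
  by lra.
have [|x [x0 [v xv] eig]] := @lambda_eigenvector R G; first by rewrite cG; lia.
have [u _ umax] := @arg_maxP _ _ _ v xpredT x isT.
have {}umax w : x w <= x u by exact: umax.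
have xu : 0 < x u by apply: lt_le_trans xv _.
(* The eigenvector is divided by its largest entry, so that its maximum, attained at [u], is 1. *)
have [||||dom|small] := @dominated_or_small R G (lambda R G) (fun w => x w / x u) u K4 K23 rho5.
- by move=> w; rewrite divr_ge0 // ltW.
- by move=> w; rewrite ler_pdivrMr // mul1r umax.
- by rewrite divff // gt_eqF.
- by move=> w; rewrite mulrA eig mulr_suml.
- by rewrite -cG; exact: dominating_lambda_le dom.
- by apply: fan_lambda_ge; [lia|lra|rewrite -cG].
Qed.
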